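(* Let $\mathbb{P}=(P,\leq)$ be a finite poset, let $(C,d)$ be a $\mathbb{P}$-filtered chain complex over $\mathbb{Z}_2$ of finite dimension $n$, and let $B$ be a fixed $d$-admissible basis of $(C,d)$. Given as input the $n\times n$ matrix $A$ of the boundary homomorphism $d$ in the basis $B$, the algorithm ConnectMat outputs a connection matrix of $(C,d)$ in $O(n^3)$ time.
   Context: All vector spaces are finite dimensional over $\mathbb{Z}_2$; all matrices have entries in $\mathbb{Z}_2$; $\mathbb{I}_n=(1,2,\ldots,n)$. A basis is an ordered tuple $B=(b_1,\ldots,b_n)$. **Filtered chain complexes.** A chain complex $(C,d)$ is a vector space $C=\bigoplus_{q\in\mathbb{Z}}C_q$ with a linear map $d:C\to C$ such that $d(C_q)\subset C_{q-1}$ and $d^2=0$. A chain map $\varphi:(C,d)\to(C',d')$ is a linear map with $\varphi(C_q)\subset C'_q$ and $d'\varphi=\varphi d$. A chain homotopy joining chain maps $\varphi,\psi:(C,d)\to(C',d')$ is a linear map $S:C\to C'$ with $S(C_q)\subset C'_{q+1}$ and $\psi-\varphi=d'S+Sd$. A $P$-gradation of a vector space $V$ is a collection of subspaces $(V_p)_{p\in P}$ with $V=\bigoplus_{p\in P}V_p$. A linear map $h:V\to V'$ between $P$-graded spaces is identified with the matrix $[h_{pq}]_{p,q\in P}$, where $h_{pq}:V_q\to V'_p$ is the inclusion of $V_q$ into $V$, followed by $h$, followed by projection onto $V'_p$; $h$ is $\mathbb{P}$-filtered if $h_{pq}\neq 0$ implies $p\leq q$. A $\mathbb{P}$-filtered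 chain complex is a chain complex $(C,d)$ with a $P$-gradation $C=\bigoplus_{p\in P}C_p$ such that $d$ is $\mathbb{P}$-filtered. Two filtered chain complexes $(C,d)$, $(C',d')$ are filtered chain homotopic if there are $\mathbb{P}$-filtered chain maps $\varphi:(C,d)\to(C',d')$, $\varphi':(C',d')\to(C,d)$ such that $\varphi'\varphi$ is joined with $\mathrm{id}_C$, and $\varphi\varphi'$ with $\mathrm{id}_{C'}$, by $\mathbb{P}$-filtered chain homotopies. **Connection matrix.** A Conley complex of a filtered chain complex $(C,d)$ is any filtered chain complex $(\bar C,\bar d)$ which is filtered chain homotopic to $(C,d)$ and satisfies $\bar d_{pp}=0$ for all $p\in P$. A connection matrix of $(C,d)$ is the matrix of homomorphisms $[\bar d_{pq}]_{p,q\in P}$ for any Conley complex $(\bar C,\bar d)$ of $(C,d)$; each homomorphism is itself represented as a matrix (in a $P$-graded basis of $\bar C$), so a connection matrix is given as a matrix with $\mathbb{Z}_2$ entries representing $\bar d$. **Admissible bases.** A basis $B=(b_1,\ldots,b_n)$ of $C$ is $P$-graded if $B\subset\bigcup_{p\in P}C_p$; then $\nu(i)$ denotes the unique $p\in P$ with $b_i\in C_p$. A $P$-graded basis $B$ is $d$-admissible if there is a linear order $\leq_{\mathrm{lin}}$ on $P$ extending $\leq$ such that $i\leq j$ implies $\nu(i)\leq_{\mathrm{lin}}\nu(j)$, and the matrix $A$ of $d$ in basis $B$ (defined by $d b_j=\sum_i A[i,j]\,b_i$) is strictly upper triangular: $A[i,j]\neq 0$ implies $i<j$. **Low, homogeneous,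 targetable.** $\mathrm{low}_A(j)$ is the row index of the lowest $1$ (largest row index) in column $A[\cdot,j]$ if this column is nonzero, and $\mathrm{low}_A(j)=0$ otherwise. If $i=\mathrm{low}_A(j)\neq 0$, column $i$ is the target of column $j$. Column $j$ is homogeneous if it is nonzero and $\nu(j)=\nu(\mathrm{low}_A(j))$. A column is targetable if it is the target of a homogeneous column. $J_h(A)$ and $J_t(A)$ denote the sets of (indices of) homogeneous and targetable columns of $A$, respectively. **Algorithm ConnectMat.** Input: the $n\times n$ matrix $A$ of $d$ in a fixed $d$-admissible basis (with the grades $\nu$). The variable $A$ is modified as follows. For $j:=1$ to $n$: for $i:=\mathrm{low}_A(j)$ down to $1$: if $A[i,j]=1$: let $S:=\{s\in\mathbb{I}_n\mid s\neq j,\ \mathrm{low}_A(s)=i,\ A[\cdot,s]\text{ is homogeneous}\}$; if $S\neq\varnothing$, let $s:=\min S$, add column $A[\cdot,s]$ to column $A[\cdot,j]$, and then add row $A[j,\cdot]$ to row $A[s,\cdot]$. Finally let $J:=\mathbb{I}_n\setminus J_h(A)\setminus J_t(A)$ and return $A$ restricted to the columns and rows with indices in $J$.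
   Formalization: The filtered chain complex is additionally assumed to have compatible gradations: each C_p is a Z-graded subspace, i.e. C_p is the sum of its intersections with the C_q; without this a Conley complex, hence a connection matrix, may fail to exist. *)

(* Defs.v *)
From mathcomp Require Import all_boot all_order all_algebra.

Set Implicit Arguments.
Unset Strict Implicit.
Unset Printing Implicit Defensive.

Import Order.TTheory GRing.Theory.
Local Open Scope ring_scope.

(** * Filtered chain complexes over Z_2 *)

(* V is finite dimensional, so V is the direct sum of the V_q (q in Z) iff
   every finite subfamily is independent and some finite subfamily spans V. *)
Definition Zgradation (V : vectType 'F_2) (G : int -> {vspace V}) : Prop :=
  (forall r : seq int, uniq r -> directv (\sum_(q <- r) G q)) /\
  (exists2 r : seq int, uniq r & (\sum_(q <- r) G q)%VS = fullv).

Record chainComplex := ChainComplex {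
  space :> vectType 'F_2;
  Zcomp : int -> {vspace space};
  bnd : 'End(space);
  Zcomp_gradation : Zgradation Zcomp;
  bnd_deg : forall q : int, (bnd @: Zcomp q <= Zcomp (q - 1))%VS;
  bnd_bnd : (bnd \o bnd)%VF = 0 }.

Definition chain_map (C C' : chainComplex) (phi : 'Hom(C, C')) : Prop :=
  (forall q : int, (phi @: Zcomp C q <= Zcomp C' q)%VS) /\
  (bnd C' \o phi)%VF = (phi \o bnd C)%VF.

Definition chain_homotopy (C C' : chainComplex) (phi psi S : 'Hom(C, C')) :
  Prop :=
  (forall q : int, (S @: Zcomp C q <= Zcomp C' (q + 1))%VS) /\
  psi - phi = (bnd C' \o S)%VF + (S \o bnd C)%VF.

Section Filtered.
Variables (disp : Order.disp_t) (P : finPOrderType disp).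

Definition Pgradation (V : vectType 'F_2) (G : P -> {vspace V}) : Prop :=
  directv (\sum_p G p) /\ (\sum_p G p)%VS = fullv.

(* The entry h_pq : V_q -> V'_p.  When G' is a P-gradation of V',
   [sumv_pi (\sum_r G' r)%VS p] is the projection of V' onto G' p along the
   other summands; [vsproj] only corestricts it to the subspace type. *)
Definition hom_entry (V V' : vectType 'F_2)
    (G : P -> {vspace V}) (G' : P -> {vspace V'}) (h : 'Hom(V, V')) (p q : P) :
    'Hom(subvs_of (G q), subvs_of (G' p)) :=
  (linfun (vsproj (G' p)) \o sumv_pi (\sum_r G' r)%VS p \o h
     \o linfun (@vsval _ _ (G q)))%VF.

Definition filtered (V V' : vectType 'F_2)
    (G : P -> {vspace V}) (G' : P -> {vspace V'}) (h : 'Hom(V, V')) : Prop :=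
  forall p q : P, hom_entry G G' h p q <> 0 -> (p <= q)%O.

Record filteredComplex := FilteredComplex {
  cpx :> chainComplex;
  Pcomp : P -> {vspace cpx};
  Pcomp_gradation : Pgradation Pcomp;
  bnd_filtered : filtered Pcomp Pcomp (bnd cpx) }.

(* Every C_p is a Z-graded subspace of C.  Without this compatibility of the two
   gradations a filtered complex need not have a Conley complex: take du = v,
   a cycle w with deg w != deg v, C_1 = <v + w> and C_2 = <v, u + w>. *)
Definition compatible_gradations (C : filteredComplex) : Prop :=
  forall p : P, exists r : seq int,
    Pcomp C p = (\sum_(q <- r) (Pcomp C p :&: Zcomp C q))%VS.

Definition filtered_homotopic (C C' : filteredComplex) : Prop :=
  exists (phi : 'Hom(C, C')) (phi' : 'Hom(C', C))
         (S : 'Hom(C, C)) (S' : 'Hom(C', C')),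
    [/\ chain_map phi /\ filtered (Pcomp C) (Pcomp C') phi,
        chain_map phi' /\ filtered (Pcomp C') (Pcomp C) phi',
        chain_homotopy (phi' \o phi)%VF \1%VF S /\
          filtered (Pcomp C) (Pcomp C) S
      & chain_homotopy (phi \o phi')%VF \1%VF S' /\
          filtered (Pcomp C') (Pcomp C') S'].

Definition conley_complex (C Cbar : filteredComplex) : Prop :=
  filtered_homotopic Cbar C /\
  forall p : P, hom_entry (Pcomp Cbar) (Pcomp Cbar) (bnd Cbar) p p = 0.

(** * Bases and matrices *)

Definition bnd_matrix (C : chainComplex) n (B : n.-tuple C) : 'M['F_2]_n :=
  \matrix_(i, j) coord B i (bnd C (tnth B j)).

Definition graded_basis (C : filteredComplex) n (B : n.-tuple C)
    (nu : 'I_n -> P) : Prop :=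
  basis_of fullv B /\ forall i, tnth B i \in Pcomp C (nu i).

Definition linear_extension (lin : rel P) : Prop :=
  [/\ reflexive lin, antisymmetric lin, transitive lin, total lin
    & forall p q : P, (p <= q)%O -> lin p q].

Definition admissible (C : filteredComplex) n (B : n.-tuple C)
    (nu : 'I_n -> P) : Prop :=
  [/\ graded_basis B nu,
      exists2 lin : rel P, linear_extension lin &
        forall i j : 'I_n, (i <= j)%N -> lin (nu i) (nu j)
    & forall i j : 'I_n, bnd_matrix B i j != 0 -> (i < j)%N].

(* The grades g of the basis elements determine the blocks [M_pq] of M. *)
Definition connection_matrix (C : filteredComplex) m (g : 'I_m -> P)
    (M : 'M['F_2]_m) : Prop :=
  exists (Cbar : filteredComplex) (Bbar : m.-tuple Cbar),
    [/\ conley_complex C Cbar, graded_basis Bbar g & M = bnd_matrix Bbar].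

(** * ConnectMat *)

Section Algorithm.
Variables (n : nat) (nu : 'I_n -> P).
Implicit Types (A : 'M['F_2]_n) (i j s : 'I_n).

(* Row i : 'I_n has number i.+1, and the value 0 means that the column is zero;
   so [low A j == i.+1] says that row i carries the lowest 1 of column j. *)
Definition low A j : nat := (\max_(i < n | (A i j != 0)%R) i.+1)%N.

Definition homogeneous A j : bool :=
  [exists i : 'I_n, (low A j == i.+1) && (nu j == nu i)].

Definition Jh A : {set 'I_n} := [set j | homogeneous A j].
Definition Jt A : {set 'I_n} :=
  [set i : 'I_n | [exists j, homogeneous A j && (low A j == i.+1)]].

(* add column s to column j *)
Definition addcol s j A : 'M['F_2]_n :=
  \matrix_(k, l) (if l == j then A k j + A k s else A k l).

(* add row j to row s *)
Definition addrow j s A : 'M['F_2]_n :=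
  \matrix_(k, l) (if k == s then A s l + A j l else A k l).

Definition candidates A i j : {set 'I_n} :=
  [set s | [&& s != j, low A s == i.+1 & homogeneous A s]].

Definition inner_step j A i : 'M['F_2]_n :=
  if A i j == 1 then
    let S := candidates A i j in
    if [pick s in S | [forall t in S, (s <= t)%N]] is Some s
    then addrow j s (addcol s j A)
    else A
  else A.

Definition outer_step A j : 'M['F_2]_n :=
  foldl (inner_step j) A (rev [seq i : 'I_n <- enum 'I_n | (i < low A j)%N]).

Definition reduce A : 'M['F_2]_n := foldl outer_step A (enum 'I_n).

Definition kept A : {set 'I_n} := ~: (Jh (reduce A) :|: Jt (reduce A)).

Definition ConnectMat A : 'M['F_2]_#|kept A| :=
  \matrix_(k, l) reduce A (enum_val k) (enum_val l).

Definition kept_grade A (k : 'I_#|kept A|) : P := nu (enum_val k).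

End Algorithm.
End Filtered.

(** * A unit-cost machine with registers, arrays and bounded loops *)

(* Registers and arrays are named by numbers; one-dimensional arrays use second
   index 0.  Every node of an expression, every assignment, test and loop
   iteration costs one time unit. *)

Inductive expr :=
  | Cst of nat
  | Reg of nat
  | Get of nat & expr & expr
  | Add of expr & expr
  | Eqn of expr & expr
  | Neq of expr & expr
  | And of expr & expr.

Inductive cmd :=
  | SetR of nat & expr
  | Put of nat & expr & expr & expr
  | Then of cmd & cmd
  | When of expr & cmd
  | Up of nat & expr & expr & cmd
  | Down of nat & expr & expr & cmd.

Record memory := Memory { reg : nat -> nat; arr : nat -> nat -> nat -> nat }.

Definition set_reg (m : memory) (x v : nat) : memory :=
  Memory (fun y => if y == x then v else reg m y) (arr m).

Definition set_arr (m : memory) (a k l v : nat) : memory :=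
  Memory (reg m) (fun b k' l' =>
    if [&& b == a, k' == k & l' == l] then v else arr m b k' l').

Fixpoint eval (m : memory) (e : expr) : nat :=
  match e with
  | Cst k => k
  | Reg x => reg m x
  | Get a e1 e2 => arr m a (eval m e1) (eval m e2)
  | Add e1 e2 => (eval m e1 + eval m e2)%N
  | Eqn e1 e2 => eval m e1 == eval m e2
  | Neq e1 e2 => eval m e1 != eval m e2
  | And e1 e2 => (eval m e1 != 0%N) && (eval m e2 != 0%N)
  end.

Fixpoint ecost (e : expr) : nat :=
  match e with
  | Cst _ | Reg _ => 1
  | Get _ e1 e2 | Add e1 e2 | Eqn e1 e2 | Neq e1 e2 | And e1 e2 =>
      (ecost e1 + ecost e2).+1
  end.

(* Final memory and elapsed time.  [Up x e1 e2 c] and [Down x e1 e2 c] run c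
   for x = e1, e1 + 1, ..., e2 and x = e1, e1 - 1, ..., e2 respectively; the
   bounds are evaluated once, on entry. *)
Fixpoint exec (c : cmd) (m : memory) : memory * nat :=
  let loop x (ks : seq nat) (body : memory -> memory * nat) t0 :=
    foldl (fun st k => let: (m', t) := body (set_reg st.1 x k) in
                       (m', (st.2 + t).+1)) (m, t0) ks in
  match c with
  | SetR x e => (set_reg m x (eval m e), (ecost e).+1)
  | Put a e1 e2 e =>
      (set_arr m a (eval m e1) (eval m e2) (eval m e),
       (ecost e1 + ecost e2 + ecost e).+1)
  | Then c1 c2 =>
      let: (m1, t1) := exec c1 m in
      let: (m2, t2) := exec c2 m1 in (m2, (t1 + t2)%N)
  | When e c1 =>
      if eval m e != 0%N
      then let: (m1, t1) := exec c1 m in (m1, (ecost e + t1).+1)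
      else (m, (ecost e).+1)
  | Up x e1 e2 c1 =>
      loop x (iota (eval m e1) ((eval m e2).+1 - eval m e1)) (exec c1)
        (ecost e1 + ecost e2).+1
  | Down x e1 e2 c1 =>
      loop x (rev (iota (eval m e2) ((eval m e1).+1 - eval m e2))) (exec c1)
        (ecost e1 + ecost e2).+1
  end.

Declare Scope prog_scope.
Delimit Scope prog_scope with prog.
Bind Scope prog_scope with expr cmd.
Infix ";;" := Then (at level 90, right associativity) : prog_scope.

Definition rN := 0%N.     (* n *)
Definition rI := 1%N.
Definition rJ := 2%N.
Definition rS := 3%N.
Definition rK := 4%N.
Definition rT := 5%N.
Definition rM := 6%N.     (* size of the returned matrix *)

Definition aA := 0%N.     (* the matrix, as 0/1 entries *)
Definition aNu := 1%N.    (* grades *)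
Definition aLow := 2%N.
Definition aDrop := 3%N.  (* flags of homogeneous and targetable columns *)
Definition aIdx := 4%N.   (* the remaining indices, in increasing order *)
Definition aOut := 5%N.   (* the returned matrix *)

Definition A_ e1 e2 := Get aA e1 e2.
Definition Nu_ e := Get aNu e (Cst 0).
Definition Low_ e := Get aLow e (Cst 0).
Definition Drop_ e := Get aDrop e (Cst 0).
Definition Idx_ e := Get aIdx e (Cst 0).

Section Program.
Local Notation N := (Reg rN).
Local Notation I := (Reg rI).
Local Notation J := (Reg rJ).
Local Notation S := (Reg rS).
Local Notation K := (Reg rK).
Local Notation T := (Reg rT).
Local Notation M := (Reg rM).

Definition compute_lows : cmd :=
  Up rS (Cst 1) N (
    Put aLow S (Cst 0) (Cst 0) ;;
    Up rK (Cst 1) N (When (A_ K S) (Put aLow S (Cst 0) K))).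

(* The pseudocode does not say how the sets S are found.  Here aLow is refreshed
   once per column j, at a cost of order n^2, and each S is then searched with
   the stored values.  [Neq] on 0/1 values is addition in Z_2. *)
Definition ConnectMat_prog : cmd :=
  Up rJ (Cst 1) N (
    compute_lows ;;
    Down rI (Low_ J) (Cst 1) (
      When (A_ I J) (
        SetR rT (Cst 0) ;;
        Down rS N (Cst 1) (
          When (And (Neq S J) (And (Eqn (Low_ S) I) (Eqn (Nu_ S) (Nu_ I))))
            (SetR rT S)) ;;
        When (Neq T (Cst 0)) (
          Up rK (Cst 1) N (Put aA K J (Neq (A_ K J) (A_ K T))) ;;
          Up rK (Cst 1) N (Put aA T K (Neq (A_ T K) (A_ J K))))))) ;;
  compute_lows ;;
  Up rS (Cst 1) N (Put aDrop S (Cst 0) (Cst 0)) ;;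
  Up rS (Cst 1) N (
    When (And (Low_ S) (Eqn (Nu_ S) (Nu_ (Low_ S)))) (
      Put aDrop S (Cst 0) (Cst 1) ;;
      Put aDrop (Low_ S) (Cst 0) (Cst 1))) ;;
  SetR rM (Cst 0) ;;
  Up rS (Cst 1) N (
    When (Eqn (Drop_ S) (Cst 0)) (
      SetR rM (Add M (Cst 1)) ;;
      Put aIdx M (Cst 0) S)) ;;
  Up rI (Cst 1) M (
    Up rJ (Cst 1) M (Put aOut I J (A_ (Idx_ I) (Idx_ J)))).

End Program.

(* Grades may be coded by arbitrary numbers, as long as distinct grades get
   distinct codes; all other memory cells are arbitrary. *)
Definition holds_input (disp : Order.disp_t) (P : finPOrderType disp) n
    (nu : 'I_n -> P) (A : 'M['F_2]_n) (m : memory) : Prop :=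
  [/\ reg m rN = n,
      forall i j : 'I_n, arr m aA i.+1 j.+1 = (A i j != 0)
    & forall i j : 'I_n,
        (arr m aNu i.+1 0%N == arr m aNu j.+1 0%N) = (nu i == nu j)].

Definition holds_output (disp : Order.disp_t) (P : finPOrderType disp) n
    (nu : 'I_n -> P) (A : 'M['F_2]_n) (m : memory) : Prop :=
  [/\ reg m rM = #|kept nu A|,
      forall k : 'I_#|kept nu A|, arr m aIdx k.+1 0%N = (enum_val k).+1
    & forall k l : 'I_#|kept nu A|,
        arr m aOut k.+1 l.+1 = (ConnectMat nu A k l != 0)].

(* Main.v *)
Require Import Defs.
From HB Require Import structures.
From mathcomp Require Import all_boot all_order all_algebra zify.

(** Every step of ConnectMat that modifies the matrix is a conjugation by a filtered
    involution, so the final matrix R still represents d.  Processed columns stay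
    strictly upper triangular, homogeneous columns of R have distinct lows, and the
    rows of R at targetable indices vanish outside the homogeneous columns.  The
    block of R from the homogeneous columns to the targetable rows then has a
    filtered inverse, and contracting it leaves exactly the returned matrix D: there
    are filtered X, Y, S with A X = X D, D Y = Y A, Y X = 1, 1 - X Y = A S + S A.

    The basis need not be homogeneous for the Z-gradation, so X and Y do not respect
    degrees.  Let p be the degree 0 part of X Y; it is homotopic to 1 by the degree
    1 part of S.  On the diagonal blocks p^2 - p squares to 0, so a power
    E = p^(2^N) is idempotent (characteristic 2).  Then Y E X is unipotent, and
    phi = E X, psi = (Y E X)^-1 Y E satisfy psi phi = 1 and phi psi = E.  Since E has
    degree 0, the images under psi of the C_q grade the complex of D, and phi, psi
    become chain maps of degree 0. *)

Set Implicit Arguments.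
Unset Strict Implicit.
Unset Printing Implicit Defensive.

Import Order.TTheory GRing.Theory.
Local Open Scope ring_scope.

(** * Filtered matrices and the reduction *)

(** Triangularity of the whole matrix is not an invariant of the reduction. What survives is weaker:
    an entry on or below the diagonal of an unprocessed column lies in a row [s] such that [s] is
    the least unprocessed homogeneous column with its low, and the low of [s] is already small.

    The plain restriction to the remaining indices is the contracted differential, without a Schur
    complement correction. Indeed d^2 = 0 also forces the rows of R at homogeneous indices to
    vanish, so the remaining columns are supported on the remaining rows.

    The degree 0 parts of X and Y need not compose to the identity, hence the detour through an
    idempotent. It succeeds because D has zero diagonal blocks, which makes A p strictly filtered.

    The idempotent, and the inverses used in the contraction and the homogenisation, are explicit
    powers. In characteristic 2 the exponent 2^k is additive on commuting matrices, so nilpotent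
    remainders disappear, and a power of a filtered matrix is again filtered, which a mere inverse
    would not show. *)

Lemma F2_neq0 (x : 'F_2) : x != 0 -> x = 1.
Proof. by case: x => [] [|[|m]] // h _; apply: val_inj. Qed.

Lemma F2_addxx (x : 'F_2) : x + x = 0.
Proof. by case: x => [] [|[|m]] // h; apply: val_inj. Qed.

Lemma F2mx_addxx m n (M : 'M['F_2]_(m, n)) : M + M = 0.
Proof. by apply/matrixP=> i j; rewrite !mxE F2_addxx. Qed.

Lemma F2mx_oppE m n (M : 'M['F_2]_(m, n)) : - M = M.
Proof. by apply/eqP; rewrite -subr_eq0 -opprD F2mx_addxx oppr0. Qed.

Section FilteredMatrices.
Variables (disp : Order.disp_t) (P : finPOrderType disp).

Definition filt m n (g : 'I_m -> P) (h : 'I_n -> P) (M : 'M['F_2]_(m, n)) :=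
  forall i j, M i j != 0 -> (g i <= h j)%O.

Definition sfilt m n (g : 'I_m -> P) (h : 'I_n -> P) (M : 'M['F_2]_(m, n)) :=
  forall i j, M i j != 0 -> (g i < h j)%O.

Lemma mulmx_neq0 m n p (M : 'M['F_2]_(m, n)) (N : 'M_(n, p)) i k :
  (M *m N) i k != 0 -> exists2 j, M i j != 0 & N j k != 0.
Proof.
rewrite mxE => nz; have [j Hj|H] := pickP (fun j => (M i j != 0) && (N j k != 0)).
  by case/andP: Hj; exists j.
case/eqP: nz; apply: big1 => j _; have /negbT := H j.
by rewrite negb_and !negbK => /orP[] /eqP->; rewrite ?mul0r ?mulr0.
Qed.

Lemma filtM m n p (f : 'I_m -> P) (g : 'I_n -> P) (h : 'I_p -> P) M N :
  filt f g M -> filt g h N -> filt f h (M *m N).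
Proof.
by move=> HM HN i k /mulmx_neq0[j /HM le1 /HN le2]; apply: le_trans le1 le2.
Qed.

Lemma sfiltMl m n p (f : 'I_m -> P) (g : 'I_n -> P) (h : 'I_p -> P) M N :
  sfilt f g M -> filt g h N -> sfilt f h (M *m N).
Proof.
by move=> HM HN i k /mulmx_neq0[j /HM le1 /HN le2]; apply: lt_le_trans le1 le2.
Qed.

Lemma sfiltMr m n p (f : 'I_m -> P) (g : 'I_n -> P) (h : 'I_p -> P) M N :
  filt f g M -> sfilt g h N -> sfilt f h (M *m N).
Proof.
by move=> HM HN i k /mulmx_neq0[j /HM le1 /HN le2]; apply: le_lt_trans le1 le2.
Qed.

Lemma addmx_neq0 m n (M N : 'M['F_2]_(m, n)) i j :
  (M + N) i j != 0 -> (M i j != 0) || (N i j != 0).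
Proof.
by rewrite mxE; apply: contraR; rewrite negb_or !negbK => /andP[/eqP-> /eqP->];
   rewrite addr0.
Qed.

Lemma filtD m n (f : 'I_m -> P) (g : 'I_n -> P) M N :
  filt f g M -> filt f g N -> filt f g (M + N).
Proof. by move=> HM HN i j /addmx_neq0/orP[/HM|/HN]. Qed.

Lemma sfiltD m n (f : 'I_m -> P) (g : 'I_n -> P) M N :
  sfilt f g M -> sfilt f g N -> sfilt f g (M + N).
Proof. by move=> HM HN i j /addmx_neq0/orP[/HM|/HN]. Qed.

Lemma filt0 m n (f : 'I_m -> P) (g : 'I_n -> P) : filt f g 0.
Proof. by move=> i j; rewrite mxE eqxx. Qed.

Lemma sfilt0 m n (f : 'I_m -> P) (g : 'I_n -> P) : sfilt f g 0.
Proof. by move=> i j; rewrite mxE eqxx. Qed.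

Lemma filt1 n (f : 'I_n -> P) : filt f f 1%:M.
Proof. by move=> i j; rewrite mxE; case: (i =P j) => [->|_]; rewrite ?eqxx. Qed.

Lemma sfiltW m n (f : 'I_m -> P) (g : 'I_n -> P) M : sfilt f g M -> filt f g M.
Proof. by move=> H i j /H/ltW. Qed.

(** The inverse [W'] is carried as data so that its filteredness is available; for square matrices
    one product equation suffices. *)
Definition similar n (nu : 'I_n -> P) (A B : 'M['F_2]_n) :=
  exists W W' : 'M_n,
    [/\ filt nu nu W, filt nu nu W', W *m W' = 1%:M & A = W *m B *m W'].

Lemma similar_refl n (nu : 'I_n -> P) A : similar nu A A.
Proof.
by exists 1%:M, 1%:M; split; rewrite ?mulmx1 ?mul1mx //; apply: filt1.
Qed.

Lemma similar_trans n (nu : 'I_n -> P) A B C :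
  similar nu A B -> similar nu B C -> similar nu A C.
Proof.
move=> [W [W' [fW fW' WW' ->]]] [V [V' [fV fV' VV' ->]]].
exists (W *m V), (V' *m W'); split;
  [exact: filtM fW fV|exact: filtM fV' fW'| |by rewrite !mulmxA].
by rewrite -mulmxA (mulmxA V) VV' mul1mx.
Qed.

Lemma similar_filt n (nu : 'I_n -> P) A B :
  similar nu A B -> filt nu nu A -> filt nu nu B.
Proof.
move=> [W [W' [fW fW' WW' ->]]] fA.
have W'W := mulmx1C WW'.
suff -> : B = W' *m (W *m B *m W') *m W by exact: filtM (filtM fW' fA) fW.
by rewrite -!mulmxA W'W mulmx1 mulmxA W'W mul1mx.
Qed.

Lemma similar_sq n (nu : 'I_n -> P) A B :
  similar nu A B -> A *m A = 0 -> B *m B = 0.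
Proof.
move=> [W [W' [fW fW' WW' ->]]] sqA.
have W'W := mulmx1C WW'.
have : W' *m ((W *m B *m W') *m (W *m B *m W')) *m W = 0.
  by rewrite sqA mulmx0 mul0mx.
rewrite -!mulmxA W'W mulmx1 (mulmxA W' W) W'W mul1mx.
by rewrite (mulmxA W' W) W'W mul1mx.
Qed.

End FilteredMatrices.

(** * Lowest entries and homogeneous columns *)

Section LowHom.
Variables (disp : Order.disp_t) (P : finPOrderType disp).
Variables (n : nat) (nu : 'I_n -> P).
Implicit Types (A : 'M['F_2]_n) (i j k l s t x : 'I_n).

Lemma low_gt A j k : A k j != 0 -> (k < low A j)%N.
Proof. by move=> nz; apply: (leq_bigmax_cond (F := fun i : 'I_n => i.+1)). Qed.

Lemma low_le A j m : (forall k, A k j != 0 -> (k < m)%N) -> (low A j <= m)%N.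
Proof. by move=> H; apply/bigmax_leqP => k /H. Qed.

Lemma low_zero A j k : (low A j <= k)%N -> A k j = 0.
Proof. by move=> le; apply/eqP; apply: contraLR le => /low_gt; rewrite -ltnNge. Qed.

Lemma lowS A j : (0 < low A j)%N -> exists2 i : 'I_n, low A j = i.+1 & A i j != 0.
Proof.
move=> gt0; have [i Hi|H0] := pickP (fun i => A i j != 0); last first.
  by rewrite /low big_pred0 in gt0.
have [i0 nz max] := arg_maxnP (P := fun i => A i j != 0) (fun k : 'I_n => val k) Hi.
exists i0 => //; apply/eqP; rewrite eqn_leq low_gt // andbT.
by apply: low_le => k /max.
Qed.

Lemma low_neq0 A j i : low A j = i.+1 -> A i j != 0.
Proof.
move=> E; have [|i' E' nz] := @lowS A j; first by rewrite E.
by have -> : i = i' by apply: val_inj; move: E; rewrite E' => -[].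
Qed.

Lemma homP A j :
  reflect (exists2 i : 'I_n, low A j = i.+1 & nu j = nu i) (homogeneous nu A j).
Proof.
apply: (iffP existsP) => [[i /andP[/eqP ? /eqP ?]]|[i -> ->]]; first by exists i.
by exists i; rewrite !eqxx.
Qed.

Lemma hom_grade A j i : homogeneous nu A j -> low A j = i.+1 -> nu j = nu i.
Proof.
by case/homP=> i' -> -> [] E; congr nu; apply: val_inj.
Qed.

Lemma homE A j i : low A j = i.+1 -> homogeneous nu A j = (nu j == nu i).
Proof.
move=> E; apply/idP/eqP => [h|E2]; first exact: hom_grade E.
by apply/homP; exists i.
Qed.

End LowHom.

(** * Invariants of the column reduction *)

Section Reduction.
Variables (disp : Order.disp_t) (P : finPOrderType disp).
Variables (n : nat) (nu : 'I_n -> P) (lin : rel P) (A0 : 'M['F_2]_n).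
Hypotheses (lin_ext : linear_extension lin)
  (nu_mono : forall i j : 'I_n, (i <= j)%N -> lin (nu i) (nu j))
  (A0_filt : filt nu nu A0) (A0_sq : A0 *m A0 = 0).
Implicit Types (A : 'M['F_2]_n) (i j k l s t x : 'I_n).

Lemma nu_squeeze p i : (p <= nu i)%O -> lin (nu i) p -> p = nu i.
Proof.
by case: lin_ext => _ asym _ _ ext /ext l1 l2; apply: asym; rewrite l1.
Qed.

(** The lowest entry lies in row [i] or further down, so its grade is at least [nu j] in the linear
    extension; filteredness makes it at most [nu j] in P. The two force equality. *)
Lemma hom_entry_grade A i j : filt nu nu A -> A i j != 0 -> nu i = nu j ->
  homogeneous nu A j.
Proof.
move=> fA nz E; have lt := low_gt nz.
have [|i' E' nz'] := @lowS _ A j; first exact: leq_ltn_trans lt.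
rewrite (homE nu E'); apply/eqP/esym/nu_squeeze; first exact: fA.
by rewrite -E; apply: nu_mono; rewrite -ltnS -E'.
Qed.

Lemma candidatesP A i j s :
  reflect [/\ s != j, low A s = i.+1 & homogeneous nu A s]
          (s \in candidates nu A i j).
Proof. by rewrite inE; apply: (iffP and3P) => [] [? /eqP ? ?]; split => //; apply/eqP. Qed.

Variant inner_spec j A i : 'M['F_2]_n -> Prop :=
| InnerSkip of A i j = 0 \/ candidates nu A i j = set0 : inner_spec j A i A
| InnerAdd s of A i j = 1 & s \in candidates nu A i j
    & (forall t, t \in candidates nu A i j -> (s <= t)%N) :
    inner_spec j A i (addrow j s (addcol s j A)).

Lemma innerP j A i : inner_spec j A i (inner_step nu j A i).
Proof.
rewrite /inner_step; case: eqP => [E|/eqP NE]; last first.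
  by constructor; left; apply/eqP; apply: contraR NE => /F2_neq0->.
case: pickP => [s /andP[sS /forall_inP min]|none]; first exact: InnerAdd.
constructor; right; apply/eqP/set0Pn => -[s0 s0S].
have [s sS min] := arg_minnP (fun t : 'I_n => val t) s0S.
by have /negP[] := none s; apply/andP; split => //; apply/forall_inP.
Qed.

(** At position [(s, j)] the row addition meets the already modified entry [A j j + A j s]. The two
    hypotheses make it vanish, so the operations contribute independently. *)
Lemma addrow_addcolE j s A k l : A j j = 0 -> A j s = 0 ->
  addrow j s (addcol s j A) k l =
  A k l + (if l == j then A k s else 0) + (if k == s then A j l else 0).
Proof.
move=> Ejj Ejs; rewrite !mxE.
case: (k =P s) => [->|_]; case: (l =P j) => [->|_]; rewrite ?addr0 //.
by rewrite Ejj Ejs !addr0.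
Qed.

Lemma addrow_addcol_similar j s A : s != j -> (nu s <= nu j)%O ->
  similar nu A (addrow j s (addcol s j A)).
Proof.
move=> sj le; pose U : 'M['F_2]_n := 1%:M + delta_mx s j.
have fU : filt nu nu U.
  apply: filtD; first exact: filt1.
  by move=> a b; rewrite mxE; case: (a =P s) => [->|]; case: (b =P j) => [->|];
    rewrite ?eqxx.
have colE : addcol s j A = A *m U.
  rewrite mulmxDr mulmx1; apply/matrixP => a b; rewrite !mxE.
  rewrite (bigD1 s) //= big1 ?addr0 => [|c /negbTE cs]; last first.
    by rewrite mxE cs mulr0.
  by rewrite mxE eqxx /=; case: eqP => [->|_]; rewrite ?mulr1 ?mulr0 ?addr0.
have rowE M : addrow j s M = U *m M.
  rewrite mulmxDl mul1mx; apply/matrixP => a b; rewrite !mxE.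
  rewrite (bigD1 j) //= big1 ?addr0 => [|c /negbTE cs]; last first.
    by rewrite mxE cs andbF mul0r.
  by rewrite mxE eqxx andbT; case: eqP => [->|_]; rewrite ?mul1r ?mul0r ?addr0.
have UU : U *m U = 1%:M.
  rewrite mulmxDl mul1mx mulmxDr mulmx1 mul_delta_mx_0 1?eq_sym // addr0.
  by rewrite -addrA F2mx_addxx addr0.
exists U, U; split => //; rewrite colE rowE -!mulmxA UU mulmx1.
by rewrite mulmxA UU mul1mx.
Qed.

(** The columns with index below [j] are processed; [j] is a natural number so that it can reach
    [n]. [outer_low] confines the entries on or below the diagonal of later columns to rows that can
    have received a row addition. [outer_unproc] excludes processed columns from the cancellation
    argument for d^2 = 0. For [j = n] the last two fields become the injectivity of targets and the
    vanishing of targetable rows that the contraction requires. *)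
Record outer_inv (j : nat) A : Prop := OuterInv {
  outer_sim : similar nu A0 A;
  outer_tri : forall k x, (k < j)%N -> A x k != 0 -> (x < k)%N;
  outer_low : forall l k, (j <= l)%N -> (l <= k)%N -> A k l != 0 ->
    [/\ homogeneous nu A k, (low A k <= j)%N
      & forall t, (j <= t)%N -> homogeneous nu A t -> low A t = low A k ->
          (k <= t)%N];
  outer_unproc : forall k t i, (k < j)%N -> (j <= t)%N -> homogeneous nu A t ->
    low A t = i.+1 -> A i k = 0;
  outer_uniq : forall k t, (k < j)%N -> homogeneous nu A k ->
    homogeneous nu A t -> low A k = low A t -> k = t;
  outer_nonhom : forall k t i, (k < j)%N -> ~~ homogeneous nu A k ->
    homogeneous nu A t -> low A t = i.+1 -> A i k = 0 }.

(* [A1] is the matrix at the start of the treatment of column j, and the rows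
   i >= m have been scanned.  The last field is what makes it legitimate for the
   program to search with the lows of [A1]. *)
Record inner_inv A1 j (m : nat) A : Prop := InnerInv {
  inner_sim : similar nu A0 A;
  inner_tri : forall k x, (k <= j)%N -> A x k != 0 -> (x < k)%N;
  inner_low : forall l k, (j < l)%N -> (l <= k)%N -> A k l != 0 ->
    [/\ homogeneous nu A k, (low A k <= j)%N
      & forall t, (j < t)%N -> homogeneous nu A t -> low A t = low A k ->
          (k <= t)%N];
  inner_unproc : forall k t i, (k < j)%N -> (j < t)%N -> homogeneous nu A t ->
    low A t = i.+1 -> A i k = 0;
  inner_uniq : forall k t, (k < j)%N -> t != j -> homogeneous nu A k ->
    homogeneous nu A t -> low A k = low A t -> k = t;
  inner_nonhom : forall k t i, (k < j)%N -> t != j -> ~~ homogeneous nu A k ->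
    homogeneous nu A t -> low A t = i.+1 -> A i k = 0;
  inner_done : forall i, (m <= i)%N -> A i j != 0 -> candidates nu A i j = set0;
  inner_stable : forall t x, t != j -> (x < j)%N ->
    (low A t == x.+1) = (low A1 t == x.+1) }.

(* Adding row j' to a row s > j' can create entries below the diagonal in later
   columns; they are gone when such a column j is reached.  Otherwise choose s >= j
   with A[s,j] = 1 and the largest low i: the term A[i,s] A[s,j] = 1 cannot be
   cancelled in (A^2)[i,j] = 0. *)
Lemma outer_tri_cur j A : outer_inv j A -> forall x, A x j != 0 -> (x < j)%N.
Proof.
move=> inv x0 nz0; rewrite ltnNge; apply/negP => ge0.
pose W := [pred k : 'I_n | (j <= k)%N && (A k j != 0)].
have W0 : W x0 by rewrite /= ge0.
have [s /andP[js nzs] smax] := arg_maxnP (fun k => low A k) W0.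
have [hs ls mins] := outer_low inv (leqnn _) js nzs.
have [i Ei gi] := homP _ _ _ hs.
have /matrixP/(_ i j) := similar_sq (outer_sim inv) A0_sq.
rewrite !mxE (bigD1 s) //= (F2_neq0 nzs) (F2_neq0 (low_neq0 Ei)) big1.
  by rewrite mulr1 addr0.
(* A second nonzero term needs [k >= j], by [outer_unproc]. Then [A i k != 0] bounds the low of [k]
   from below and the choice of [s] bounds it from above, so the lows agree. Both [k] and [s] are
   least among the unprocessed columns with this low, hence equal. *)
move=> k ks; have [Akj0|Akj] := eqVneq (A k j) 0; first by rewrite Akj0 mulr0.
have [kj|jk] := ltnP k j.
  by rewrite (outer_unproc inv kj js hs Ei) mul0r.
have [Aik0|Aik] := eqVneq (A i k) 0; first by rewrite Aik0 mul0r.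
have Wk : W k by rewrite /= jk.
have [hk lk mink] := outer_low inv (leqnn _) jk Akj.
have Elow : low A k = low A s.
  by apply/eqP; rewrite eqn_leq (smax _ Wk : (_ <= _)%N) /= Ei low_gt.
case/eqP: ks; apply: val_inj; apply/eqP; rewrite eqn_leq.
by rewrite mins // mink.
Qed.

Lemma inner_start j A : outer_inv j A -> inner_inv A j (low A j) A.
Proof.
move=> inv; split => //.
- exact: outer_sim inv.
- move=> k x; rewrite leq_eqVlt => /orP[/eqP/val_inj->|/(outer_tri inv) H]; last exact: H.
  exact: outer_tri_cur.
- move=> l k jl lk nz; have [h1 h2 h3] := outer_low inv (ltnW jl) lk nz.
  by split => // t /ltnW; apply: h3.
- by move=> k t i kj /ltnW; apply: (outer_unproc inv kj).
- by move=> k t kj _ hk ht; apply: (outer_uniq inv kj hk ht).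
- by move=> k t i kj _ hk ht; apply: (outer_nonhom inv kj hk ht).
- by move=> i le nz; have := low_gt nz; rewrite ltnNge le.
Qed.

Lemma outer_next A1 j A : inner_inv A1 j 0 A -> outer_inv j.+1 A.
Proof.
move=> inv; have fA := similar_filt (inner_sim inv) A0_filt.
have uniqj t : homogeneous nu A j -> homogeneous nu A t -> low A j = low A t -> j = t.
  move=> hj ht El; apply/eqP; rewrite eq_sym; apply: contraT => tj.
  have [i Ei _] := homP _ _ _ hj.
  have /setP/(_ t) := inner_done inv (leq0n i) (low_neq0 Ei).
  by rewrite in_set0 => /candidatesP[]; split=> //; rewrite -El.
have donej t i : t != j -> homogeneous nu A t -> low A t = i.+1 -> A i j = 0.
  move=> tj ht Et; apply/eqP; apply: contraT => nz.
  have /setP/(_ t) := inner_done inv (leq0n i) nz.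
  by rewrite in_set0 => /candidatesP[].
split.
- exact: inner_sim inv.
- by move=> k x; rewrite ltnS => kj; apply: (inner_tri inv kj).
- move=> l k jl lk nz; have [h1 h2 h3] := inner_low inv jl lk nz.
  by split => //; apply: leqW.
- move=> k t i; rewrite ltnS leq_eqVlt => /orP[/eqP/val_inj->|kj] jt.
    by apply: donej; rewrite -val_eqE /= neq_ltn jt orbT.
  by move=> ht Et; apply: (inner_unproc inv kj jt ht Et).
- move=> k t; rewrite ltnS leq_eqVlt => /orP[/eqP/val_inj->|kj]; first exact: uniqj.
  have [->|tj] := eqVneq t j; last by move=> hk ht; apply: (inner_uniq inv kj tj hk ht).
  by move=> hk hj El; apply/esym/uniqj.
- move=> k t i; rewrite ltnS leq_eqVlt => /orP[/eqP/val_inj->|kj] nh ht Et.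
    by apply: (donej t i _ ht Et); apply: contraNneq _ nh => <-.
  have [Etj|tj] := eqVneq t j; last exact: (inner_nonhom inv kj tj nh ht Et).
  (* Row [i] is now the low of column [j] itself, so [nu i = nu j]. A nonzero entry in an earlier
     column [k] squeezes [nu k] to the same grade, which would make column [k] homogeneous. *)
  subst t; apply/eqP; apply: contraNT nh => nz; apply: (hom_entry_grade fA nz).
  apply/nu_squeeze; first exact: (fA _ _ nz).
  by rewrite -(hom_grade ht Et); apply/nu_mono/ltnW.
Qed.

(** Row [j] vanishes left of the diagonal, so the processed columns do not change. A later column
    [t] changes only if [A j t != 0]; this entry survives because [s != j], so the lowest entry is
    in row [j] or further down both before and after. Hence the columns other than [j] with a given
    low in a row above [j] stay the same, and so does their homogeneity. *)
Lemma inner_next A1 j A i : inner_inv A1 j i.+1 A ->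
  inner_inv A1 j i (inner_step nu j A i).
Proof.
move=> inv; have fA := similar_filt (inner_sim inv) A0_filt.
case: innerP => [skip|s Aij sS mins].
  case: inv => h1 h2 h3 h4 h5 h6 h7 h8; split => // i'; rewrite leq_eqVlt.
  by case/orP=> [/eqP/val_inj<-|]; [case: skip => [->|]; rewrite ?eqxx|exact: h7].
have [sj Es hs] := candidatesP _ _ _ _ sS.
have nzij : A i j != 0 by rewrite Aij.
have ij : (i < j)%N by apply: (inner_tri inv) nzij.
have zero_above k x : low A k = i.+1 -> (i < x)%N -> A x k = 0.
  by move=> E lt; apply: low_zero; rewrite E.
have Ajj : A j j = 0.
  by apply/eqP; apply: contraT => /(inner_tri inv (leqnn j)); rewrite ltnn.
have Ajs : A j s = 0 by apply: zero_above.
have Ajk k : (k < j)%N -> A j k = 0.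
  move=> kj; apply/eqP; apply: contraT => /(inner_tri inv (ltnW kj)) jk.
  by have := ltn_trans kj jk; rewrite ltnn.
have sles : (nu s <= nu j)%O by rewrite (hom_grade hs Es); apply: fA.
have simB := addrow_addcol_similar A sj sles.
have BE k l := addrow_addcolE k l Ajj Ajs.
set B := addrow j s (addcol s j A) in simB BE *.
have Bcol t x : t != j -> A j t = 0 -> B x t = A x t.
  by move=> /negbTE tj E; rewrite BE tj E if_same !addr0.
have Bcolj x : B x j = A x j + A x s.
  by rewrite BE eqxx Ajj if_same addr0.
have Blow t : t != j -> A j t = 0 -> low B t = low A t.
  by move=> tj E; apply: eq_bigl => x; rewrite Bcol.
have Bjt t : t != j -> B j t = A j t.
  by move=> /negbTE tj; rewrite BE tj eq_sym (negbTE sj) !addr0.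
have lowB t x : t != j -> (x < j)%N -> (low B t == x.+1) = (low A t == x.+1).
  move=> tj xj; have [E|nz] := eqVneq (A j t) 0; first by rewrite Blow.
  have l1 := low_gt nz; have := nz; rewrite -Bjt // => /low_gt l2.
  by rewrite !gtn_eqF //; apply: leq_trans l1 || apply: leq_trans l2.
have lowB' t x : t != j -> (x < j)%N -> low A t = x.+1 -> low B t = x.+1.
  by move=> tj xj E; apply/eqP; rewrite lowB ?E.
have lowA' t x : t != j -> (x < j)%N -> low B t = x.+1 -> low A t = x.+1.
  by move=> tj xj E; apply/eqP; rewrite -lowB ?E.
have homB' t x : t != j -> (x < j)%N -> low B t = x.+1 ->
    homogeneous nu B t = homogeneous nu A t.
  by move=> tj xj E; rewrite (homE nu E) (homE nu (lowA' _ _ tj xj E)).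
have colk k x : (k < j)%N -> B x k = A x k.
  by move=> kj; apply: Bcol; [rewrite -val_eqE /= neq_ltn kj|apply: Ajk].
have lowk k : (k < j)%N -> low B k = low A k.
  by move=> kj; apply: Blow; [rewrite -val_eqE /= neq_ltn kj|apply: Ajk].
have homk k : (k < j)%N -> homogeneous nu B k = homogeneous nu A k.
  by move=> kj; rewrite /homogeneous lowk.
have neq_lt k : (k < j)%N -> k != j by move=> kj; rewrite -val_eqE /= neq_ltn kj.
have neq_gt k : (j < k)%N -> k != j by move=> kj; rewrite -val_eqE /= neq_ltn kj orbT.
split.
- exact: similar_trans (inner_sim inv) simB.
- move=> k x; rewrite leq_eqVlt => /orP[/eqP/val_inj->|kj]; last first.
    by rewrite colk //; apply: (inner_tri inv (ltnW kj)).
  rewrite Bcolj; have [E|nz _] := eqVneq (A x s) 0.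
    by rewrite E addr0; apply: (inner_tri inv (leqnn j)).
  by apply: leq_ltn_trans ij; have := low_gt nz; rewrite Es ltnS.
- move=> l k jl lk nz.
  have kj : k != j by apply/neq_gt/(leq_trans jl).
  suff [hk lowk' mink] : [/\ homogeneous nu A k, (low A k <= j)%N & forall t,
      (j < t)%N -> homogeneous nu A t -> low A t = low A k -> (k <= t)%N].
    have [x Ex _] := homP _ _ _ hk.
    have xj : (x < j)%N by rewrite Ex in lowk'.
    have EB := lowB' _ _ kj xj Ex.
    split; rewrite ?(homB' _ _ kj xj EB) ?EB ?Ex // => t jt ht Et.
    apply: mink => //; first by rewrite -(homB' _ _ (neq_gt _ jt) xj Et).
    by rewrite Ex; apply: lowA' => //; apply: neq_gt.
  have [E|nzA] := eqVneq (A k l) 0; last exact: (inner_low inv jl lk nzA).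
  move: nz; rewrite BE E (negbTE (neq_gt _ jl)) !add0r.
  (* A new entry can only appear in row [s]. Taking the least candidate as [s] is what yields the
     minimality demanded by [inner_low]. *)
  case: (k =P s) => [->|_]; last by rewrite eqxx.
  move=> _; split=> //; first by rewrite Es.
  move=> t jt ht Et; apply: mins; apply/candidatesP; split => //; first exact: neq_gt.
  by rewrite Et.
- move=> k t x kj jt ht Et; rewrite colk //.
  apply/eqP; apply: contraT => nz.
  have xj : (x < j)%N by apply: ltn_trans (inner_tri inv (ltnW kj) nz) kj.
  have Et' := lowA' _ _ (neq_gt _ jt) xj Et.
  rewrite (homB' _ _ (neq_gt _ jt) xj Et) in ht.
  by rewrite (inner_unproc inv kj jt ht Et') eqxx in nz.
- move=> k t kj tj; rewrite homk // lowk // => hk ht El.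
  have [x Ex _] := homP _ _ _ hk.
  have xj : (x < j)%N by apply: ltn_trans (inner_tri inv (ltnW kj) (low_neq0 Ex)) kj.
  rewrite Ex in El; rewrite (homB' _ _ tj xj (esym El)) in ht.
  by apply: (inner_uniq inv kj tj hk ht); rewrite Ex; apply/esym/lowA'.
- move=> k t x kj tj; rewrite homk // colk // => hk ht Et.
  apply/eqP; apply: contraT => nz.
  have xj : (x < j)%N by apply: ltn_trans (inner_tri inv (ltnW kj) nz) kj.
  have Et' := lowA' _ _ tj xj Et.
  rewrite (homB' _ _ tj xj Et) in ht.
  by rewrite (inner_nonhom inv kj tj hk ht Et') eqxx in nz.
- move=> x; rewrite leq_eqVlt Bcolj => /orP[/eqP/val_inj<-|ix].
    by rewrite Aij (F2_neq0 (low_neq0 Es)) F2_addxx eqxx.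
  rewrite (zero_above _ _ Es ix) addr0 => nz.
  have xj := inner_tri inv (leqnn j) nz.
  apply/setP=> t; rewrite in_set0; apply/negP => /candidatesP[tj Et ht].
  have /setP/(_ t) := inner_done inv ix nz; rewrite in_set0 => /candidatesP[].
  by split=> //; [apply: lowA'|rewrite -(homB' _ _ tj xj Et)].
- by move=> t x tj xj; rewrite lowB // (inner_stable inv).
Qed.

Lemma filter_lt_enumS i (m : nat) : m = i ->
  [seq k : 'I_n <- enum 'I_n | (k < m.+1)%N] =
  rcons [seq k : 'I_n <- enum 'I_n | (k < m)%N] i.
Proof.
move=> Em; apply: (inj_map val_inj); rewrite map_rcons.
have E q : (q <= n)%N -> map val [seq k : 'I_n <- enum 'I_n | (k < q)%N] = iota 0 q.
  move=> qn; transitivity [seq k <- map val (enum 'I_n) | (k < q)%N].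
    by rewrite filter_map.
  rewrite val_enum_ord.
  have -> : n = (q + (n - q))%N by rewrite subnKC.
  rewrite iotaD filter_cat (_ : filter _ (iota 0 q) = iota 0 q); last first.
    by apply/all_filterP/allP => x; rewrite mem_iota.
  rewrite (_ : filter _ _ = [::]) ?cats0 //; apply/eqP; rewrite -(negbK (_ == _)) -has_filter.
  by apply/hasPn => x; rewrite mem_iota add0n -leqNgt => /andP[].
have Hm : (m < n)%N by rewrite Em.
rewrite !E // ?(ltnW Hm) // -addn1 iotaD add0n /= cats1 Em //.
Qed.

Definition scan j A m : 'M['F_2]_n :=
  foldl (inner_step nu j) A (rev [seq i : 'I_n <- enum 'I_n | (i < m)%N]).

Lemma scanS j A i (m : nat) : m = i ->
  scan j A m.+1 = scan j (inner_step nu j A i) m.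
Proof. by move=> E; rewrite /scan (filter_lt_enumS E) rev_rcons. Qed.

Lemma scan0 j A : scan j A 0 = A.
Proof. by rewrite /scan (eq_filter (a2 := pred0)) ?filter_pred0. Qed.

Lemma low_ltn A j : (low A j <= n)%N.
Proof. by apply: low_le => k _. Qed.

Lemma scan_inv A1 j A m : (m <= n)%N -> inner_inv A1 j m A ->
  inner_inv A1 j 0 (scan j A m).
Proof.
elim: m A => [|m IHm] A mn inv; first by rewrite scan0.
rewrite (@scanS _ _ (Ordinal mn)) //; apply: IHm (ltnW mn) _.
exact: (inner_next (i := Ordinal mn) inv).
Qed.

Lemma outer_step_inv j A : outer_inv j A -> outer_inv j.+1 (outer_step nu A j).
Proof.
by move=> /inner_start/(scan_inv (low_ltn _ _))/outer_next.
Qed.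

Definition reduce_upto m := foldl (outer_step nu) A0 [seq j : 'I_n <- enum 'I_n | (j < m)%N].

Lemma reduce_upto0 : reduce_upto 0 = A0.
Proof. by rewrite /reduce_upto (eq_filter (a2 := pred0)) ?filter_pred0. Qed.

Lemma reduce_uptoS j : reduce_upto j.+1 = outer_step nu (reduce_upto j) j.
Proof. by rewrite /reduce_upto (@filter_lt_enumS j) // -cats1 foldl_cat. Qed.

Lemma reduce_upton : reduce_upto n = reduce nu A0.
Proof.
rewrite /reduce_upto /reduce; congr foldl.
by apply/all_filterP/allP=> j _ /=.
Qed.

Hypothesis A0_tri : forall i j, A0 i j != 0 -> (i < j)%N.

Lemma reduce_upto_inv m : (m <= n)%N -> outer_inv m (reduce_upto m).
Proof.
elim: m => [_|m IHm mn].
  rewrite reduce_upto0; split=> //; first exact: similar_refl.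
  by move=> l k _ lk /A0_tri; rewrite ltnNge lk.
have -> : m = Ordinal mn by [].
by rewrite reduce_uptoS; apply: outer_step_inv; apply: IHm (ltnW mn).
Qed.

Lemma reduce_inv : outer_inv n (reduce nu A0).
Proof. by rewrite -reduce_upton; apply: reduce_upto_inv. Qed.

End Reduction.

(** * Contraction of the homogeneous columns *)

Section Powers.
Variable n : nat.
Implicit Types M N : 'M['F_2]_n.

Lemma F2mx_sqrD M N : M *m N = N *m M ->
  (M + N) *m (M + N) = M *m M + N *m N.
Proof.
move=> MN; rewrite mulmxDl !mulmxDr MN addrA -(addrA (M *m M)) F2mx_addxx.
by rewrite addr0.
Qed.

(** Iterated Frobenius: the cross terms [M N + N M] of a square cancel. *)
Lemma F2mx_expD M N k : M *m N = N *m M ->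
  (M + N) ^+ (2 ^ k) = M ^+ (2 ^ k) + N ^+ (2 ^ k).
Proof.
move=> MN; elim: k => [|k IHk]; first by rewrite !expr1.
rewrite expnSr !exprM IHk !(expr2 (_ ^+ _)); apply: F2mx_sqrD.
by apply: commrX; apply/commr_sym/commrX/commr_sym.
Qed.

(** The function [f] is a rank: a nonzero entry of the q-th power raises it by at least [q], while
    all its values are below [b]. *)
Lemma mx_nilp M (f : 'I_n -> nat) b :
    (forall i j, M i j != 0 -> (f i < f j)%N) -> (forall i, f i < b)%N ->
  forall k, (b <= k)%N -> M ^+ k = 0.
Proof.
move=> Mf fb k bk; apply/matrixP => i j; rewrite [RHS]mxE.
apply/eqP; apply: contraT => nz.
suff H : forall q i j, (M ^+ q) i j != 0 -> (f i + q <= f j)%N.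
  have := leq_ltn_trans (H _ _ _ nz) (fb j).
  by rewrite ltnNge (leq_trans bk) ?leq_addl.
elim=> [|q IHq] a c.
  by rewrite expr0 mxE; case: (a =P c) => [->|_]; rewrite ?addn0 ?eqxx.
rewrite exprS => /mulmx_neq0[d /Mf ad /IHq dc].
by rewrite addnS -addSn (leq_trans _ dc) // leq_add2r.
Qed.

End Powers.

Section FilteredPowers.
Variables (disp : Order.disp_t) (P : finPOrderType disp).
Variables (n : nat) (nu : 'I_n -> P).

Lemma filtX M k : filt nu nu M -> filt nu nu (M ^+ k).
Proof.
move=> fM; elim: k => [|k IHk]; first exact: filt1.
by rewrite exprS; apply: filtM fM IHk.
Qed.

(** The rank of an index is the number of grades strictly below its own, which is always less than
    the number of grades. *)
Lemma sfilt_nilp M k : sfilt nu nu M -> (#|P| <= k)%N -> M ^+ k = 0.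
Proof.
move=> sM; apply: (mx_nilp (f := fun i => #|[pred r | (r < nu i)%O]|)) => [i j /sM lt|i].
  apply: proper_card; apply/properP; split.
    by apply/subsetP => r; rewrite !inE => /lt_trans; apply.
  by exists (nu i); rewrite !inE ?ltxx.
apply: proper_card; apply/properP; split; first by apply/subsetP.
by exists (nu i); rewrite !inE ?ltxx.
Qed.

End FilteredPowers.

(** * Coordinate projections and inclusions *)

Section Selections.
Variable n : nat.
Implicit Types Z : {set 'I_n}.

Definition diagset Z : 'M['F_2]_n := \matrix_(i, j) ((i == j) && (i \in Z))%:R.

Lemma diagsetE Z p (M : 'M_(n, p)) i j :
  (diagset Z *m M) i j = if i \in Z then M i j else 0.
Proof.
rewrite mxE (bigD1 i) //= big1 ?addr0 => [|k ki].
  by rewrite mxE eqxx; case: (i \in Z); rewrite ?mul1r ?mul0r.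
by rewrite mxE eq_sym (negbTE ki) mul0r.
Qed.

Lemma diagsetEr Z p (M : 'M_(p, n)) i j :
  (M *m diagset Z) i j = if j \in Z then M i j else 0.
Proof.
rewrite mxE (bigD1 j) //= big1 ?addr0 => [|k ki].
  by rewrite mxE eqxx; case: (j \in Z); rewrite ?mulr1 ?mulr0.
by rewrite mxE (negbTE ki) mulr0.
Qed.

Definition inclset Z : 'M['F_2]_(n, #|Z|) := \matrix_(i, k) (i == enum_val k)%:R.

Lemma inclsetE Z p (M : 'M_(p, n)) i k : (M *m inclset Z) i k = M i (enum_val k).
Proof.
rewrite mxE (bigD1 (enum_val k)) //= big1 ?addr0 => [|l li].
  by rewrite mxE eqxx mulr1.
by rewrite mxE (negbTE li) mulr0.
Qed.

Lemma inclset_trE Z p (M : 'M_(n, p)) k j :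
  ((inclset Z)^T *m M) k j = M (enum_val k) j.
Proof. by rewrite -[_ *m M]trmxK mxE trmx_mul trmxK inclsetE mxE. Qed.

Lemma inclset_trK Z : (inclset Z)^T *m inclset Z = 1%:M.
Proof.
by apply/matrixP => k l; rewrite inclset_trE !mxE (inj_eq enum_val_inj).
Qed.

Lemma inclset_tr Z : inclset Z *m (inclset Z)^T = diagset Z.
Proof.
apply/matrixP => i j; rewrite -[in RHS](mulmx1 (diagset Z)) diagsetE !mxE.
case: ifPn => iZ; last first.
  apply: big1 => k _; rewrite !mxE; case: (i =P enum_val k) => [E|_].
    by case/negP: iZ; rewrite E enum_valP.
  by rewrite mul0r.
rewrite (bigD1 (enum_rank_in iZ i)) //= !mxE enum_rankK_in // eqxx mul1r eq_sym.
rewrite big1 ?addr0 // => k; rewrite !mxE; case: (i =P enum_val k) => [E /eqP[]|_ _].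
  by apply: enum_val_inj; rewrite enum_rankK_in.
by rewrite mul0r.
Qed.

End Selections.

(** * Contraction along a unitriangular block *)

Section Contraction.
Variables (disp : Order.disp_t) (P : finPOrderType disp).
Variables (n : nat) (nu : 'I_n -> P) (A : 'M['F_2]_n).
Variables (H : {set 'I_n}) (tau : 'I_n -> 'I_n).
Hypotheses (fA : filt nu nu A) (sqA : A *m A = 0).
Hypotheses (nu_tau : {in H, forall h, nu (tau h) = nu h})
  (tau_inj : {in H &, injective tau})
  (tau_notin : {in H, forall h, tau h \notin H})
  (A_tau : {in H, forall h, A (tau h) h = 1})
  (A_tau_le : {in H &, forall h k, A (tau h) k != 0 -> (tau h <= tau k)%N})
  (A_tau_out : forall h k, h \in H -> k \notin H -> A (tau h) k = 0).

Let T := tau @: H.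
Let J := ~: (H :|: T).

(* S inverts A from the target columns back to the homogeneous ones; the filtered
   inverse of the unitriangular block M = Q A is its power M^(2^n - 1). *)
Lemma contraction :
  let D := \matrix_(k, l) A (enum_val k) (enum_val l) : 'M_#|J| in
  let g := fun k : 'I_#|J| => nu (enum_val k) in
  exists X Y S,
    [/\ [/\ filt nu g X, filt g nu Y & filt nu nu S],
        [/\ A *m X = X *m D, D *m Y = Y *m A & Y *m X = 1%:M]
      & 1%:M + X *m Y = A *m S + S *m A].
Proof.
move=> D g.
pose pH := diagset H; pose pT := diagset T; pose pJ := diagset J.
(* [Q] sends the basis vector of a target [tau h] back to that of [h] and kills the others, so [Q A]
   moves the rows at targets to the rows in [H]. *)
pose Q : 'M['F_2]_n := \matrix_(h, t) ((h \in H) && (t == tau h))%:R.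
have QE p (M : 'M_(n, p)) h j : (Q *m M) h j = if h \in H then M (tau h) j else 0.
  rewrite mxE; case: ifPn => hH; last first.
    by apply: big1 => k _; rewrite mxE (negbTE hH) mul0r.
  rewrite (bigD1 (tau h)) //= big1 ?addr0 => [|k ki]; first by rewrite mxE hH eqxx mul1r.
  by rewrite mxE (negbTE ki) andbF mul0r.
pose M := Q *m A.
have pHQ : pH *m Q = Q.
  by apply/matrixP => i j; rewrite diagsetE; case: ifPn => // iH; rewrite mxE (negbTE iH).
have pHpH : pH *m pH = pH.
  by apply/matrixP => i j; rewrite diagsetE; case: ifPn => // iH; rewrite mxE (negbTE iH) andbF.
have QpT : Q *m pT = Q.
  apply/matrixP => i j; rewrite diagsetEr mxE; case: ifPn => // jT.
  by case: andP => // -[iH /eqP E]; case/negP: jT; rewrite E imset_f.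
have MpH : M *m pH = M.
  apply/matrixP => i j; rewrite diagsetEr QE.
  by case: ifPn => // jH; case: ifPn => // iH; rewrite A_tau_out.
have pHM : pH *m M = M by rewrite mulmxA pHQ.
have QtQ : Q^T *m Q = pT.
  apply/matrixP => t u; rewrite mxE [RHS]mxE.
  have [/imsetP[h hH ->]|tT] := boolP (t \in T); last first.
    rewrite andbF; apply: big1 => k _; rewrite !mxE; case: andP => [[kH /eqP E]|_].
      by case/negP: tT; rewrite E imset_f.
    by rewrite mul0r.
  rewrite (bigD1 h) //= !mxE hH eqxx mul1r andbT eq_sym big1 ?addr0 // => k kh.
  rewrite !mxE; case: andP => [[kH /eqP /tau_inj E]|]; rewrite ?mul0r //.
  by case/eqP: kh; rewrite E.
have pow k : M ^+ (2 ^ k) = pH ^+ (2 ^ k) + (M + pH) ^+ (2 ^ k).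
  rewrite -F2mx_expD; first by rewrite addrCA F2mx_addxx addr0.
  by rewrite mulmxDr mulmxDl MpH pHM.
have pow_pH k : pH ^+ (2 ^ k) = pH.
  by elim: k => // k IHk; rewrite expnSr exprM IHk.
(* Removing the diagonal [pH] leaves a matrix strictly triangular for the order of the targets. Its
   ranks are at most [n], and [n < 2 ^ n], so the power kills it. *)
have Mn : M ^+ (2 ^ n) = pH.
  rewrite pow (mx_nilp (M := M + pH) (b := n.+1)
    (f := fun i => if i \in H then (tau i).+1 else 0%N)).
  - by rewrite addr0.
  - move=> i j; rewrite mxE QE; have [iH|iH] := ifPn; last first.
      by rewrite [pH _ _]mxE (negbTE iH) andbF addr0 eqxx.
    have [jH|jH] := ifPn; last first.
      rewrite A_tau_out // add0r mxE iH andbT; case: (i =P j) => [E|_]; last by rewrite eqxx.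
      by rewrite -E iH in jH.
    rewrite [pH _ _]mxE iH andbT ltnS; case: (i =P j) => [->|ij].
      by rewrite A_tau // F2_addxx eqxx.
    rewrite addr0 ltn_neqAle => /A_tau_le -> //; rewrite andbT.
    by apply/eqP => /val_inj E; apply/ij/tau_inj.
  - by move=> i; case: ifP => // _; rewrite ltnS.
  - exact: ltn_expl.
pose N := M ^+ (2 ^ n).-1; pose S := N *m Q.
have NM : N *m M = pH by rewrite -[N *m M]/(N * M) -exprSr prednK ?expn_gt0.
have MN : M *m N = pH by rewrite -[M *m N]/(M * N) -exprS prednK ?expn_gt0.
have SA : S *m A = pH by rewrite -mulmxA.
have SpT : S *m pT = S by rewrite -mulmxA QpT.
have pTAS : pT *m A *m S = pT.
  rewrite -QtQ -!mulmxA (mulmxA A) (mulmxA Q) (mulmxA Q) -/M MN.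
  by rewrite pHQ.
(* Since [pH] equals [S A], d^2 = 0 makes the rows of [A] at homogeneous indices vanish. *)
have pHA : pH *m A = 0 by rewrite -SA -mulmxA sqA mulmx0.
have ppp : pH + pT + pJ = 1%:M.
  apply/matrixP => i j; rewrite !mxE !inE; case: eqP => _ /=; last by rewrite !addr0.
  have [iH|] := boolP (i \in H); last by case: (i \in T); rewrite ?addr0 ?add0r.
  have /negbTE-> : i \notin T.
    by apply: contraL iH => /imsetP[h hH ->]; apply: tau_notin.
  by rewrite /= !addr0.
pose X := inclset J.
have pX (Z : {set 'I_n}) : [disjoint Z & J] -> diagset Z *m X = 0.
  move=> /pred0P disj; apply/matrixP => i k; rewrite diagsetE !mxE.
  case: ifP => // iZ; case: eqP => // E; have := disj i.
  by rewrite /= iZ E enum_valP.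
have pHX : pH *m X = 0 by apply: pX; rewrite disjoints_subset setCK subsetUl.
have pTX : pT *m X = 0 by apply: pX; rewrite disjoints_subset setCK subsetUr.
have SX : S *m X = 0 by rewrite -SpT -mulmxA pTX mulmx0.
have XX : X *m X^T = pJ by apply: inclset_tr.
have DE : D = X^T *m A *m X by apply/matrixP => k l; rewrite inclsetE inclset_trE mxE.
have [Y YE] : exists Y, Y = X^T *m (1%:M + A *m S) by eexists.
pose e := 1%:M + A *m S + pH.
(* As [S A = pH], [e] is [1 + A S + S A]. Its rows in [H] vanish by [pHA] and those in [T] by
   [pTAS], so only the rows in [J] remain. *)
have XY : X *m Y = e.
  have -> : X *m Y = pJ + pJ *m (A *m S) by rewrite YE [LHS]mulmxA XX mulmxDr mulmx1.
  have -> : e = (pH + pT + pJ) *m e by rewrite ppp mul1mx.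
  have pHpT : pT *m pH = 0.
    apply/matrixP => i j; rewrite diagsetE !mxE; case: ifP => // iT.
    case: andP => // -[_ iH]; case/imsetP: iT => h hH E.
    by move: iH; rewrite E (negbTE (tau_notin hH)).
  have pJpH : pJ *m pH = 0.
    apply/matrixP => i j; rewrite diagsetE !mxE; case: ifP => //.
    by rewrite !inE negb_or => /andP[/negbTE-> _]; rewrite andbF.
  rewrite !mulmxDl !mulmxDr !mulmx1 (mulmxA pT) pTAS (mulmxA pH) pHA mul0mx pHpH pHpT pJpH.
  by rewrite !addr0 !F2mx_addxx !add0r.
(* The rows in [H] are zero, and the rows in [T] are zero outside the columns in [H]. The columns in
   [J] are therefore supported on [J], which makes the bare restriction [D] the right
   differential. *)
have AX : A *m X = X *m D.
  rewrite DE !mulmxA XX.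
  have -> : A *m X = (pH + pT + pJ) *m A *m X by rewrite ppp mul1mx.
  rewrite !mulmxDl pHA mul0mx -QtQ -!mulmxA (mulmxA Q) -/M -MpH.
  by rewrite -(mulmxA M) pHX !mulmx0 !add0r mulmxA.
have DY : D *m Y = Y *m A.
  rewrite -[D]mul1mx -(inclset_trK J) -/X -!mulmxA (mulmxA X D) -AX -!mulmxA XY.
  rewrite -[RHS]mul1mx -(inclset_trK J) -/X -!mulmxA (mulmxA X Y) XY.
  congr (_ *m _); rewrite /e mulmxDr mulmxDl mulmxDr mulmxDl mul1mx mulmx1.
  by rewrite pHA mulmxA sqA mul0mx !addr0 -SA mulmxA.
have YX : Y *m X = 1%:M.
  by rewrite YE -mulmxA mulmxDl -mulmxA SX mulmx0 addr0 mul1mx inclset_trK.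
have fX : filt nu g X by move=> i k; rewrite mxE; case: (i =P _) => [->|]; rewrite ?eqxx.
have fXt : filt g nu X^T by move=> k i; rewrite !mxE; case: (i =P _) => [->|]; rewrite ?eqxx.
have fQ : filt nu nu Q.
  move=> i j; rewrite mxE; case: andP => [[iH /eqP->]|]; rewrite ?eqxx //.
  by rewrite nu_tau.
have fS : filt nu nu S by apply: (filtM _ fQ); apply/filtX/(filtM fQ fA).
exists X, Y, S; split; last 2 first.
- by split.
- by rewrite XY SA addrA addrA F2mx_addxx add0r.
split=> //; rewrite YE; apply: (filtM fXt); exact: filtD (@filt1 _ _ _ _) (filtM fA fS).
Qed.

End Contraction.

(** * Contraction of the reduced matrix *)

Section ReduceContraction.
Variables (disp : Order.disp_t) (P : finPOrderType disp).
Variables (n : nat) (nu : 'I_n -> P) (lin : rel P) (A0 : 'M['F_2]_n).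
Hypotheses (lin_ext : linear_extension lin)
  (nu_mono : forall i j : 'I_n, (i <= j)%N -> lin (nu i) (nu j))
  (A0_filt : filt nu nu A0) (A0_sq : A0 *m A0 = 0)
  (A0_tri : forall i j, A0 i j != 0 -> (i < j)%N).

(** A kept column is not homogeneous, so by [hom_entry_grade] it has no entry at its own grade. This
    gives the vanishing diagonal blocks of a Conley complex. *)
Lemma ConnectMat_sfilt :
  sfilt (kept_grade (nu := nu) (A := A0)) (kept_grade (nu := nu) (A := A0))
    (ConnectMat nu A0).
Proof.
have inv := reduce_inv lin_ext nu_mono A0_filt A0_sq A0_tri.
have fR := similar_filt (outer_sim inv) A0_filt.
move=> k l; rewrite mxE => nz; rewrite lt_neqAle fR // andbT.
apply/eqP => E; have := enum_valP l; rewrite !inE negb_or => /andP[/negP nh _]; apply: nh.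
exact: (hom_entry_grade lin_ext nu_mono fR nz E).
Qed.

Lemma ConnectMat_contraction :
  let D := ConnectMat nu A0 in
  let g := kept_grade (nu := nu) (A := A0) in
  exists X Y S,
    [/\ [/\ filt nu g X, filt g nu Y & filt nu nu S],
        [/\ A0 *m X = X *m D, D *m Y = Y *m A0 & Y *m X = 1%:M]
      & 1%:M + X *m Y = A0 *m S + S *m A0].
Proof.
move=> D g; have inv := reduce_inv lin_ext nu_mono A0_filt A0_sq A0_tri.
have fR := similar_filt (outer_sim inv) A0_filt.
have sqR := similar_sq (outer_sim inv) A0_sq.
have [W [W' [fW fW' WW' A0E]]] := outer_sim inv.
pose R := reduce nu A0; pose H := Jh nu R.
(* The default is returned only for zero columns, and these are not in [H]. *)
pose tau (h : 'I_n) := odflt h [pick i : 'I_n | low R h == i.+1].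
have lowR h : h \in H -> low R h = (tau h).+1.
  rewrite inE => /homP[i Ei _]; rewrite /tau; case: pickP => [k /eqP //|/(_ i)].
  by rewrite Ei eqxx.
have tauE h : h \in H -> nu (tau h) = nu h.
  move=> hH; have Eh := lowR _ hH; rewrite inE in hH.
  by rewrite (hom_grade hH Eh).
have tau_inj : {in H &, injective tau}.
  move=> h k hH kH E; have := hH; have := kH; rewrite !inE => hk hh.
  by apply: (outer_uniq inv (ltn_ord h) hh hk); rewrite !lowR // E.
have R_tau h : h \in H -> R (tau h) h = 1.
  by move=> hH; apply/F2_neq0/low_neq0/lowR.
have R_le : {in H &, forall h k, R (tau h) k != 0 -> (tau h <= tau k)%N}.
  by move=> h k hH kH /low_gt; rewrite lowR.
have R_out h k : h \in H -> k \notin H -> R (tau h) k = 0.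
  move=> hH kH; have := hH; have := kH; rewrite !inE => nk hh.
  exact: (outer_nonhom inv (ltn_ord k) nk hh (lowR _ hH)).
have WJ : Jt nu R = tau @: H.
  apply/setP => i; rewrite inE; apply/existsP/imsetP => [[h /andP[hh /eqP E]]|[h hH ->]].
    have hH : h \in H by rewrite inE.
    by exists h => //; apply: val_inj; move: E; rewrite (lowR _ hH) => -[].
  by exists h; rewrite (lowR _ hH) eqxx andbT; rewrite inE in hH.
(* A homogeneous target tau h would put a combination of homogeneous columns,
   which have distinct lows, in the kernel of R. *)
have tau_notin h : h \in H -> tau h \notin H.
  move=> hH; apply/negP => tH.
  pose Z := [pred k | (k \in H) && (R k h != 0)].
  have Z0 : Z (tau h) by rewrite /= tH R_tau.
  have [s /andP[sH nz] smax] := arg_maxnP (fun k => val (tau k)) Z0.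
  have /matrixP/(_ (tau s) h) := sqR; rewrite !mxE (bigD1 s) //= -/R (R_tau _ sH).
  rewrite (F2_neq0 nz) mulr1 big1 ?addr0 // => k ks.
  have [->|nzk] := eqVneq (R k h) 0; first by rewrite mulr0.
  have [kH|kH] := boolP (k \in H); last by rewrite R_out ?mul0r.
  have [->|/(R_le _ _ sH kH) le] := eqVneq (R (tau s) k) 0; first by rewrite mul0r.
  case/eqP: ks; apply: tau_inj => //; apply: val_inj; apply/eqP.
  by rewrite eqn_leq le andbT; apply: smax; rewrite /= kH.
(* The index types depend on the set, and [kept nu A0] agrees with the complement of [H] and its
   targets only through [WJ]; a variable [J] with an equation avoids transporting matrices. *)
have contr J : J = ~: (H :|: tau @: H) ->
    let D := \matrix_(k, l) R (enum_val k) (enum_val l) : 'M_#|J| in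
    let g := fun k : 'I_#|J| => nu (enum_val k) in
    exists X Y S,
    [/\ [/\ filt nu g X, filt g nu Y & filt nu nu S],
        [/\ R *m X = X *m D, D *m Y = Y *m R & Y *m X = 1%:M]
      & 1%:M + X *m Y = R *m S + S *m R].
  by move=> ->; apply: contraction.
have [|X [Y [S [[fX fY fS] [RX DY YX] XY]]]] := contr (kept nu A0).
  by rewrite -WJ.
have W'W := mulmx1C WW'.
have AW : A0 *m W = W *m R by rewrite {1}A0E -mulmxA W'W mulmx1.
have WA : W' *m A0 = R *m W' by rewrite {1}A0E !mulmxA W'W mul1mx.
exists (W *m X), (Y *m W'), (W *m S *m W'); split.
- split; [exact: filtM fW fX|exact: filtM fY fW'|exact: filtM (filtM fW fS) fW'].
- split.
  + by rewrite mulmxA AW -!mulmxA RX.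
  + by rewrite mulmxA DY -!mulmxA WA.
  + by rewrite mulmxA -(mulmxA Y) W'W mulmx1.
- rewrite !mulmxA AW -(mulmxA (W *m S)) WA -!mulmxA -mulmxDr !mulmxA.
  rewrite -mulmxDl -XY.
  by rewrite mulmxDl mul1mx mulmxDr WW' !mulmxA.
Qed.

End ReduceContraction.

(** * Homogenisation *)

Section Degree0.
Variables (disp : Order.disp_t) (P : finPOrderType disp) (n : nat).
Variables (nu : 'I_n -> P) (A : 'M['F_2]_n) (Pi : int -> 'M['F_2]_n).

(** The matrices [Pi q] play the projections onto the degrees, so these are the filtered chain maps
    of degree 0. They form an algebra, which keeps every polynomial in [p] inside. *)
Definition degree0 (M : 'M['F_2]_n) :=
  [/\ filt nu nu M, A *m M = M *m A & forall q, M *m Pi q = Pi q *m M].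

Lemma degree0_1 : degree0 1%:M.
Proof. by split=> [||q]; rewrite ?mulmx1 ?mul1mx //; apply: filt1. Qed.

Lemma degree0D M N : degree0 M -> degree0 N -> degree0 (M + N).
Proof.
move=> [fM AM PM] [fN AN PN]; split; first exact: filtD.
  by rewrite mulmxDr mulmxDl AM AN.
by move=> q; rewrite mulmxDr mulmxDl PM PN.
Qed.

Lemma degree0M M N : degree0 M -> degree0 N -> degree0 (M *m N).
Proof.
move=> [fM AM PM] [fN AN PN]; split; first exact: filtM fM fN.
  by rewrite mulmxA AM -!mulmxA AN.
by move=> q; rewrite -mulmxA PN !mulmxA PM.
Qed.

Lemma degree0X M k : degree0 M -> degree0 (M ^+ k).
Proof.
move=> dM; elim: k => [|k IHk]; first exact: degree0_1.
by rewrite exprS; apply: degree0M dM IHk.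
Qed.

Variables (h p : 'M['F_2]_n).
Hypotheses (fA : filt nu nu A) (fh : filt nu nu h) (p_degree0 : degree0 p)
  (sfilt_Ap : sfilt nu nu (A *m p)) (p_htpy : 1%:M + p = A *m h + h *m A)
  (h_deg : forall q, h *m Pi q = Pi (q + 1) *m h).

(** [p (1 + p) = A p h + p h A], where the first summand contains the strictly filtered [A p]. In
    the square, the product of the second summand with itself is [p h (A p) h A], which contains it
    too. *)
Lemma sfilt_pp_p : sfilt nu nu ((p *m p + p) *m (p *m p + p)).
Proof.
have [fp Ap _] := p_degree0; have sAp := sfilt_Ap.
have E : p *m p + p = A *m p *m h + p *m h *m A.
  rewrite -{3}[p]mulmx1 -mulmxDr addrC p_htpy.
  by rewrite mulmxDr !mulmxA Ap.
have s1 : sfilt nu nu (A *m p *m h) by apply: sfiltMl sAp fh.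
have f2 : filt nu nu (p *m h *m A) by apply: (filtM _ fA); apply: filtM fp fh.
rewrite E mulmxDl; apply: sfiltD.
  by apply: (sfiltMl s1); apply: filtD _ f2; apply: sfiltW.
rewrite mulmxDr; apply: sfiltD; first exact: sfiltMr f2 s1.
rewrite !mulmxA; apply: (sfiltMl _ fA); apply: (sfiltMl _ fh).
by rewrite -!mulmxA; apply: (sfiltMr fp); apply: (sfiltMr fh).
Qed.

Let E := p ^+ (2 ^ #|P|.+1).

(** One factor 2 of the exponent provides the square of [sfilt_pp_p]; the remaining [2 ^ #|P|]
    exceeds the nilpotency bound. Frobenius then turns the vanishing power of [p^2 + p] into
    [E^2 + E = 0]. *)
Lemma E_idem : E *m E = E.
Proof.
have : (p *m p + p) ^+ (2 ^ #|P|.+1) = 0.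
  rewrite expnS exprM expr2 (sfilt_nilp sfilt_pp_p) //.
  exact: (ltnW (ltn_expl _ _)).
rewrite F2mx_expD ?mulmxA // => H; apply/eqP; rewrite -subr_eq0 F2mx_oppE.
rewrite -[p *m p]/(p ^+ 2) -exprM mulnC exprM in H.
by rewrite -/E in H; rewrite -[E *m E]/(E ^+ 2) H.
Qed.

Lemma sfilt_AE : sfilt nu nu (A *m E).
Proof.
have [fp _ _] := p_degree0.
have -> : E = p *m p ^+ (2 ^ #|P|.+1).-1.
  by rewrite -[_ *m _]/(_ * _) -exprS prednK ?expn_gt0.
by rewrite mulmxA; apply: sfiltMl sfilt_Ap _; apply: filtX.
Qed.

(** [1 + p^k] is [1 + p] times a geometric sum [Q] in [p]. Since [Q] is a chain map of degree 0,
    [h Q] is a homotopy of degree 1. *)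
Lemma E_homotopic_1 : exists T, [/\ filt nu nu T, 1%:M + E = A *m T + T *m A
   & forall q, T *m Pi q = Pi (q + 1) *m T].
Proof.
have H k : exists2 Q, degree0 Q & 1%:M + p ^+ k = (1%:M + p) *m Q.
  elim: k => [|k [Q dQ IH]].
    exists 0; last by rewrite expr0 F2mx_addxx mulmx0.
    by split=> [||q]; rewrite ?mulmx0 ?mul0mx //; apply: filt0.
  exists (1%:M + p *m Q); first exact: degree0D degree0_1 (degree0M p_degree0 dQ).
  rewrite mulmxDr mulmx1 (mulmxA _ p) mulmxDl mul1mx.
  have -> : p + p *m p = p *m (1%:M + p) by rewrite mulmxDr mulmx1.
  rewrite -mulmxA -IH mulmxDr mulmx1 exprS -[p * _]/(p *m _).
  by rewrite -addrA (addrA p) F2mx_addxx add0r.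
have [Q [fQ AQ PQ] EQ] := H (2 ^ #|P|.+1)%N.
exists (h *m Q); split.
- exact: filtM fh fQ.
- by rewrite EQ p_htpy mulmxDl -!mulmxA AQ.
- by move=> q; rewrite -mulmxA PQ mulmxA h_deg -mulmxA.
Qed.


End Degree0.

(** * From a filtered retraction to one of degree 0 *)

Section Homogenisation.
Variables (disp : Order.disp_t) (P : finPOrderType disp).
Variables (n m : nat) (nu : 'I_n -> P) (g : 'I_m -> P).
Variables (A S : 'M['F_2]_n) (D : 'M['F_2]_m).
Variables (X : 'M['F_2]_(n, m)) (Y : 'M['F_2]_(m, n)).
Variables (Pi : int -> 'M['F_2]_n) (r : seq int).
Hypotheses (fA : filt nu nu A) (fS : filt nu nu S) (sD : sfilt g g D)
  (fX : filt nu g X) (fY : filt g nu Y) (fPi : forall q, filt nu nu (Pi q)).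
Hypotheses (AA : A *m A = 0) (AX : A *m X = X *m D) (DY : D *m Y = Y *m A)
  (YX : Y *m X = 1%:M) (XY : 1%:M + X *m Y = A *m S + S *m A).
Hypotheses (r_uniq : uniq r) (sumPi : \sum_(q <- r) Pi q = 1%:M)
  (PiPi : forall q q', Pi q *m Pi q' = if q == q' then Pi q else 0)
  (APi : forall q, A *m Pi q = Pi (q - 1) *m A).

Lemma Pi_out q : q \notin r -> Pi q = 0.
Proof.
move=> qr; rewrite -[LHS]mulmx1 -sumPi mulmx_sumr big_seq big1 // => q' q'r.
by rewrite PiPi; case: eqP => // E; rewrite E q'r in qr.
Qed.

(** The component of [S] that raises the degree by exactly one. The degrees outside [r] contribute
    nothing, by [Pi_out]. *)
Let h := \sum_(q <- r) Pi (q + 1) *m S *m Pi q.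

Lemma h_Pi q : h *m Pi q = Pi (q + 1) *m S *m Pi q.
Proof.
rewrite mulmx_suml; have [qr|/Pi_out->] := boolP (q \in r); last first.
  by rewrite mulmx0; apply: big1 => q' _; rewrite mulmx0.
rewrite (bigD1_seq q) //= -mulmxA PiPi eqxx big1 ?addr0 // => q' q'q.
by rewrite -mulmxA PiPi (negbTE q'q) mulmx0.
Qed.

Lemma h_deg q : h *m Pi q = Pi (q + 1) *m h.
Proof.
rewrite h_Pi mulmx_sumr; have [qr|qr] := boolP (q \in r).
  rewrite (bigD1_seq q) //= !mulmxA PiPi eqxx big1 ?addr0 // => q' q'q.
  by rewrite !mulmxA PiPi (inj_eq (addIr 1)) eq_sym (negbTE q'q) !mul0mx.
rewrite (Pi_out qr) mulmx0 big_seq big1 // => q' q'r.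
rewrite !mulmxA PiPi (inj_eq (addIr 1)); case: eqP => [E|_]; last by rewrite !mul0mx.
by rewrite E q'r in qr.
Qed.

Local Notation degree0 := (degree0 nu A Pi).

Let p := 1%:M + (A *m h + h *m A).

Lemma filt_h : filt nu nu h.
Proof.
rewrite /h; elim/big_rec: _ => [|q M _ fM]; first exact: filt0.
by apply: filtD _ fM; exact: (filtM (filtM (@fPi _) fS) (@fPi q)).
Qed.

Lemma p_degree0 : degree0 p.
Proof.
have fh := filt_h.
split.
- apply: filtD (@filt1 _ _ _ _) _.
  by apply: filtD; [exact: filtM fA fh|exact: filtM fh fA].
- rewrite mulmxDr mulmxDl mulmx1 mul1mx mulmxDr mulmxDl !mulmxA AA -!mulmxA AA.
  by rewrite mul0mx mulmx0 add0r addr0.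
- move=> q; rewrite mulmxDr mulmxDl mulmx1 mul1mx mulmxDr mulmxDl -!mulmxA.
  by rewrite h_deg APi !mulmxA APi h_deg addrK subrK.
Qed.

(* p is the degree 0 part of X Y. *)
Lemma p_Pi q : p *m Pi q = Pi q *m (X *m Y) *m Pi q.
Proof.
have -> : X *m Y = 1%:M + (A *m S + S *m A).
  by rewrite -XY addrA F2mx_addxx add0r.
have -> : p *m Pi q = Pi q + (A *m (h *m Pi q) + h *m (A *m Pi q)).
  by rewrite /p !mulmxDl mul1mx -!mulmxA.
rewrite APi (mulmxA h) !h_Pi subrK.
rewrite mulmxDr mulmxDl mulmx1 PiPi eqxx mulmxDr mulmxDl.
rewrite -(mulmxA _ (Pi (q - 1))) -APi !mulmxA APi addrK.
by [].
Qed.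

(** On degree [q], [A p] is [Pi (q - 1) A X Y Pi q], and [A X = X D] brings in the strictly filtered
    [D]. *)
Lemma sfilt_Ap : sfilt nu nu (A *m p).
Proof.
rewrite -[A *m p]mulmx1 -sumPi mulmx_sumr; elim/big_rec: _ => [|q M _ sM].
  exact: sfilt0.
apply: sfiltD _ sM; rewrite -mulmxA p_Pi !mulmxA APi -(mulmxA _ A) AX.
apply: (sfiltMl _ (@fPi q)); apply: (sfiltMl _ fY); rewrite mulmxA.
by apply: (sfiltMr _ sD); apply: filtM fX.
Qed.

Lemma homogenisation : exists phi psi T,
  [/\ [/\ filt nu g phi, filt g nu psi & filt nu nu T],
      [/\ A *m phi = phi *m D, D *m psi = psi *m A & psi *m phi = 1%:M],
      1%:M + phi *m psi = A *m T + T *m A,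
      forall q, T *m Pi q = Pi (q + 1) *m T
    & forall q, phi *m psi *m Pi q = Pi q *m (phi *m psi)].
Proof.
have fh := filt_h; have dp := p_degree0; have sAp := sfilt_Ap; have hdeg := h_deg.
have htpy : 1%:M + p = A *m h + h *m A by rewrite addrA F2mx_addxx add0r.
move: (p) (h) fh dp sAp hdeg htpy => p' h' fh dp sAp hdeg htpy.
have [T [fT ET TPi]] := E_homotopic_1 fh dp htpy hdeg.
have EE := E_idem fA fh dp sAp htpy.
have [fE AE PE] := degree0X (2 ^ #|P|.+1) dp.
have sAE := sfilt_AE dp sAp.
set E := p' ^+ _ in fT ET TPi EE fE AE PE sAE.
clearbody E.
(* [s] is strictly filtered: [1 + E] is [A T + T A], and moving [A] across [Y] or [X] turns it into
   [D]. *)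
pose s := Y *m (1%:M + E) *m X; pose u := Y *m E *m X.
have uE : u = 1%:M + s.
  by rewrite /s mulmxDr mulmxDl mulmx1 YX addrA F2mx_addxx add0r.
have ss : sfilt g g s.
  rewrite /s ET mulmxDr mulmxDl mulmxA -DY; apply: sfiltD.
    by apply: (sfiltMl _ fX); apply: (sfiltMl _ fT); apply: sfiltMl sD fY.
  rewrite -!mulmxA AX !mulmxA; apply: (sfiltMr _ sD).
  by apply: (filtM _ fX); apply: filtM fY fT.
pose N := (2 ^ #|P|)%N; have N0 : (0 < N)%N by rewrite expn_gt0.
(* Frobenius gives [(1 + s)^N = 1 + s^N = 1], so the inverse of [u] is a power of [u] and hence
   filtered. *)
have uN : u ^+ N = 1%:M.
  rewrite uE F2mx_expD ?mulmx1 ?mul1mx // -[1%:M]/1 expr1n (sfilt_nilp ss) ?addr0 //.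
  exact: (ltnW (ltn_expl _ _)).
pose v := u ^+ N.-1.
have uv : u *m v = 1%:M by rewrite -[_ *m _]/(_ * _) -exprS prednK.
have vu : v *m u = 1%:M by rewrite -[_ *m _]/(_ * _) -exprSr prednK.
have vE : v = 1%:M + s *m v.
  by rewrite -uv uE mulmxDl mul1mx -addrA F2mx_addxx addr0.
have fu : filt g g u by apply: (filtM _ fX); apply: filtM fY fE.
have fv : filt g g v by apply: filtX.
have Du : D *m u = u *m D.
  by rewrite /u !mulmxA DY -!mulmxA (mulmxA A) AE -AX !mulmxA.
have Dv : D *m v = v *m D.
  by rewrite -[LHS]mul1mx -vu -mulmxA (mulmxA u) -Du -mulmxA uv mulmx1.
clearbody v s.
have [phi phiE] : exists phi, phi = E *m X by eexists.
have [psi psiE] : exists psi, psi = v *m Y *m E by eexists.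
have psiphi : psi *m phi = 1%:M.
  by rewrite psiE phiE -!mulmxA (mulmxA E) EE (mulmxA Y).
have Ephi : E *m phi = phi by rewrite phiE mulmxA EE.
have psiEE : psi *m E = psi by rewrite psiE -mulmxA EE.
(* E + phi psi is idempotent and strictly filtered. *)
have W0 : E + phi *m psi = 0.
  pose W := E + phi *m psi.
  have WW : W *m W = W.
    rewrite /W mulmxDl !mulmxDr EE (mulmxA E) Ephi -(mulmxA phi psi E) psiEE.
    by rewrite -mulmxA (mulmxA psi) psiphi mul1mx F2mx_addxx addr0.
  have sW : sfilt nu nu W.
    (* Expanding [v = 1 + s v] splits [W] into [E (1 + X Y) E], which is strictly filtered through
       [A E], and a term containing [s]. *)
    have -> : W = E *m (A *m S + S *m A) *m E + E *m X *m (s *m v) *m Y *m E.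
      rewrite -XY /W mulmxDr mulmxDl mulmx1 EE -addrA; congr (_ + _).
      by rewrite phiE psiE {1}vE !mulmxA !(mulmxDr, mulmxDl) ?mulmxA mulmx1.
    rewrite mulmxDr mulmxDl !mulmxA -AE; apply: sfiltD; last first.
      apply: (sfiltMl _ fE); apply: (sfiltMl _ fY); apply: (sfiltMl _ fv).
      by apply: (sfiltMr _ ss); apply: filtM fE fX.
    apply: sfiltD; first by apply: (sfiltMl _ fE); apply: sfiltMl sAE fS.
    by rewrite -mulmxA; apply: (sfiltMr _ sAE); apply: filtM fE fS.
  have WX k : W ^+ k.+1 = W.
    by elim: k => [|k IHk]; rewrite ?expr1 // exprS IHk; apply: WW.
  by rewrite -/W -(WX #|P|) (sfilt_nilp sW).
have EW : phi *m psi = E.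
  by apply/eqP; rewrite eq_sym -subr_eq0 F2mx_oppE W0.
exists phi, psi, T; rewrite EW; split=> //.
- split=> //; first by rewrite phiE; apply: filtM fE fX.
  by rewrite psiE; apply: (filtM _ fE); apply: filtM fv fY.
- split=> //; first by rewrite phiE mulmxA AE -!mulmxA AX.
  by rewrite psiE !mulmxA Dv -!mulmxA -AE (mulmxA D) DY !mulmxA.
Qed.

End Homogenisation.

(** * Matrices of homomorphisms *)

Section Coordinates.
Variables (V : vectType 'F_2) (n : nat) (B : n.-tuple V).
Hypothesis B_basis : basis_of fullv B.

Lemma coord_tnth i j : coord B j (tnth B i) = (i == j)%:R.
Proof. by rewrite (tnth_nth 0) coord_free // (basis_free B_basis). Qed.

Lemma sum_coord v : v = \sum_i coord B i v *: tnth B i.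
Proof.
rewrite {1}(coord_basis B_basis (memvf v)).
by apply: eq_bigr => i _; rewrite (tnth_nth 0).
Qed.

Lemma coord_inj u v : (forall i, coord B i u = coord B i v) -> u = v.
Proof. by move=> E; rewrite [u]sum_coord [v]sum_coord; apply: eq_bigr => i _; rewrite E. Qed.

Lemma coord_sum (k : 'I_n -> 'F_2) i : coord B i (\sum_j k j *: tnth B j) = k i.
Proof.
under eq_bigr => j _ do rewrite (tnth_nth 0).
by rewrite coord_sum_free // (basis_free B_basis).
Qed.

End Coordinates.

Section MatrixOfHom.
Variables (V : vectType 'F_2) (n : nat) (B : n.-tuple V).

Section Target.
Variables (V' : vectType 'F_2) (n' : nat) (B' : n'.-tuple V').

Definition mat (h : 'Hom(V, V')) : 'M['F_2]_(n', n) :=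
  \matrix_(i, j) coord B' i (h (tnth B j)).

Definition homof_fun (M : 'M['F_2]_(n', n)) (v : V) : V' :=
  \sum_i (\sum_j M i j * coord B j v) *: tnth B' i.

Lemma homof_linear M : linear (homof_fun M).
Proof.
move=> a u v; rewrite /homof_fun scaler_sumr -big_split /=; apply: eq_bigr => i _.
rewrite scalerA -scalerDl mulr_sumr -big_split /=; congr (_ *: _).
by apply: eq_bigr => j _; rewrite linearP mulrDr mulrCA.
Qed.

HB.instance Definition _ M := GRing.isLinear.Build 'F_2 V V' _ (homof_fun M)
  (homof_linear M).

Definition homof M : 'Hom(V, V') := linfun (homof_fun M).

End Target.

Hypothesis B_basis : basis_of fullv B.

Section TargetBasis.
Variables (V' : vectType 'F_2) (n' : nat) (B' : n'.-tuple V').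
Hypothesis B'_basis : basis_of fullv B'.

Lemma coord_app (h : 'Hom(V, V')) v i :
  coord B' i (h v) = \sum_j mat B' h i j * coord B j v.
Proof.
rewrite {1}[v](sum_coord B_basis) !linear_sum; apply: eq_bigr => j _.
by rewrite !linearZ mxE mulrC.
Qed.

Lemma mat_inj (f h : 'Hom(V, V')) : mat B' f = mat B' h -> f = h.
Proof.
move=> E.
have Ej j : f (tnth B j) = h (tnth B j).
  by apply: (coord_inj B'_basis) => i; have /matrixP/(_ i j) := E; rewrite !mxE.
apply/lfunP => v; rewrite [v](sum_coord B_basis) !linear_sum; apply: eq_bigr => j _.
by rewrite !linearZ /= Ej.
Qed.

Lemma homofK M : mat B' (homof B' M) = M.
Proof.
apply/matrixP => i j; rewrite mxE lfunE /= (coord_sum B'_basis) (bigD1 j) //=.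
rewrite (coord_tnth B_basis) eqxx mulr1 big1 ?addr0 // => k kj.
by rewrite (coord_tnth B_basis) eq_sym (negbTE kj) mulr0.
Qed.

Lemma matD (f h : 'Hom(V, V')) : mat B' (f + h) = mat B' f + mat B' h.
Proof. by apply/matrixP => i j; rewrite !mxE lfunE linearD. Qed.

Lemma matN (f : 'Hom(V, V')) : mat B' (- f) = - mat B' f.
Proof. by apply/matrixP => i j; rewrite !mxE lfunE linearN. Qed.

Lemma mat0 : mat B' (0 : 'Hom(V, V')) = 0.
Proof. by apply/matrixP => i j; rewrite !mxE lfunE linear0. Qed.

End TargetBasis.

Lemma mat1 : mat B \1%VF = 1%:M.
Proof. by apply/matrixP => i j; rewrite !mxE lfunE /= (coord_tnth B_basis) eq_sym. Qed.

End MatrixOfHom.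

Lemma mat_comp (V V' V'' : vectType 'F_2) n n' n'' (B : n.-tuple V)
    (B' : n'.-tuple V') (B'' : n''.-tuple V'') (B'_basis : basis_of fullv B')
    (f : 'Hom(V', V'')) (h : 'Hom(V, V')) :
  mat B B'' (f \o h)%VF = mat B' B'' f *m mat B B' h.
Proof.
apply/matrixP => i j; rewrite !mxE lfunE /= (coord_app B'_basis).
by apply: eq_bigr => k _; rewrite [mat B B' h _ _]mxE.
Qed.

(** * Bases adapted to a P-gradation *)

Section GradedBases.
Variables (disp : Order.disp_t) (P : finPOrderType disp).

Section Components.
Variables (V : vectType 'F_2) (G : P -> {vspace V}) (n : nat) (B : n.-tuple V)
  (nu : 'I_n -> P).
Hypotheses (G_grad : Pgradation G) (B_basis : basis_of fullv B)
  (B_nu : forall i, tnth B i \in G (nu i)).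

Lemma graded_components (us : P -> V) v : (forall p, us p \in G p) ->
  \sum_p us p = v -> forall p, us p = \sum_(i | nu i == p) coord B i v *: tnth B i.
Proof.
move=> usG usv p; have [dirG _] := G_grad.
have /directv_sum_unique/(_ us (fun p => \sum_(i | nu i == p) coord B i v *: tnth B i)) := dirG.
have -> : \sum_p \sum_(i | nu i == p) coord B i v *: tnth B i = v.
  rewrite [RHS](sum_coord B_basis) [RHS](partition_big nu xpredT) //=.
rewrite usv eqxx => H.
have vsG q : true -> \sum_(i | nu i == q) coord B i v *: tnth B i \in G q.
  by move=> _; apply: rpred_sum => i /eqP <-; apply/rpredZ/B_nu.
have /esym/forall_inP E := H (fun q _ => usG q)
  vsG.
by apply/eqP/E.
Qed.

Lemma sumv_piE p v : sumv_pi (\sum_r G r)%VS p v =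
  \sum_(i | nu i == p) coord B i v *: tnth B i.
Proof.
apply: (graded_components (us := fun p => sumv_pi (\sum_r G r)%VS p v)).
  by move=> q; apply: memv_sum_pi.
by apply: sumv_pi_sum; case: G_grad => _ ->; apply: memvf.
Qed.

Lemma coord_graded q v i : v \in G q -> coord B i v != 0 -> nu i = q.
Proof.
move=> vq nz; apply/eqP; apply: contraNT nz => iq; apply/eqP.
have E : (if nu i == q then v else 0) =
    \sum_(j | nu j == nu i) coord B j v *: tnth B j.
  apply: (graded_components (us := fun p => if p == q then v else 0)) => [p|].
    by case: eqP => [->|_] //; apply: mem0v.
  by rewrite -big_mkcond big_pred1_eq.
rewrite (negbTE iq) in E; have := congr1 (coord B i) E.
rewrite linear0 big_mkcond /=
  (eq_bigr (fun j => (if nu j == nu i then coord B j v else 0) *: tnth B j)).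
  by rewrite coord_sum // eqxx => <-.
by move=> j _; case: ifP; rewrite ?scale0r.
Qed.

End Components.

Section Entries.
Variables (V V' : vectType 'F_2) (G : P -> {vspace V}) (G' : P -> {vspace V'}).
Variables (n n' : nat) (B : n.-tuple V) (B' : n'.-tuple V').
Variables (nu : 'I_n -> P) (nu' : 'I_n' -> P).
Hypotheses (G_grad : Pgradation G) (B_basis : basis_of fullv B)
  (B_nu : forall i, tnth B i \in G (nu i)).
Hypotheses (G'_grad : Pgradation G') (B'_basis : basis_of fullv B')
  (B'_nu : forall i, tnth B' i \in G' (nu' i)).

Lemma hom_entryE (h : 'Hom(V, V')) p q u :
  vsval (hom_entry G G' h p q u) =
  \sum_(i | nu' i == p) coord B' i (h (vsval u)) *: tnth B' i.
Proof.
rewrite -(sumv_piE G'_grad B'_basis B'_nu) !lfunE /= lfunE /= lfunE /= lfunE /= lfunE /=.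
by rewrite vsprojK // memv_sum_pi.
Qed.

Lemma hom_entry_eq0 (h : 'Hom(V, V')) p q :
    (forall i j, nu' i = p -> nu j = q -> mat B B' h i j = 0) ->
  hom_entry G G' h p q = 0.
Proof.
move=> H; apply/lfunP => u; apply: val_inj; rewrite /= hom_entryE lfunE /=.
apply: big1 => i /eqP Ei; rewrite (coord_app B_basis) big1 ?scale0r // => j _.
have [->|nz] := eqVneq (coord B j (vsval u)) 0; first by rewrite mulr0.
by rewrite H ?mul0r // (coord_graded G_grad B_basis B_nu (subvsP u) nz).
Qed.

Lemma filteredP (h : 'Hom(V, V')) : filtered G G' h <-> filt nu' nu (mat B B' h).
Proof.
split=> [H i j|H p q /eqP]; last first.
  apply: contraR => npq; apply/eqP/hom_entry_eq0 => i j Ei Ej.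
  by apply/eqP; apply: contraR npq => /H; rewrite Ei Ej.
rewrite mxE => nz; apply: H => E.
have := hom_entryE h (nu' i) (vsproj (G (nu j)) (tnth B j)).
rewrite E vsprojK // lfunE /= => /(congr1 (coord B' i)).
rewrite linear0 big_mkcond /= (eq_bigr (fun k => (if nu' k == nu' i then
  coord B' k (h (tnth B j)) else 0) *: tnth B' k)).
  by rewrite coord_sum // eqxx => E0; rewrite -E0 eqxx in nz.
by move=> k _; case: ifP; rewrite ?scale0r.
Qed.

End Entries.

Definition basis_gradation (V : vectType 'F_2) n (B : n.-tuple V)
    (nu : 'I_n -> P) (p : P) : {vspace V} := (\sum_(i | nu i == p) <[tnth B i]>)%VS.

Lemma mem_basis_gradation (V : vectType 'F_2) n (B : n.-tuple V) nu i :
  tnth B i \in basis_gradation B nu (nu i).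
Proof. by rewrite memvE; apply: (sumv_sup i). Qed.

Lemma basis_gradationP (V : vectType 'F_2) n (B : n.-tuple V) nu :
  basis_of fullv B -> Pgradation (basis_gradation B nu).
Proof.
move=> B_basis; split; last first.
  apply/vspaceP => v; rewrite memvf [v](sum_coord B_basis); apply: rpred_sum => i _.
  apply: rpredZ; move: (mem_basis_gradation B nu i); rewrite !memvE => /subv_trans; apply.
  exact: (sumv_sup (nu i)).
have coord0 p u i : u \in basis_gradation B nu p -> nu i != p -> coord B i u = 0.
  case/memv_sumP => w wB ->; rewrite linear_sum => ip; apply: big1 => j /eqP jp.
  have /vlineP[k ->] := wB j (introT eqP jp).
  rewrite linearZ /= coord_tnth //; case: eqP => [E|]; rewrite ?mulr0 //.
  by rewrite -E jp eqxx in ip.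
apply/directv_sum_independent => us usG us0 p _.
apply: (coord_inj B_basis) => i; rewrite linear0.
have [Ei|ip] := eqVneq (nu i) p; last by rewrite (coord0 p) ?usG.
have := congr1 (coord B i) us0; rewrite linear0 linear_sum (bigD1 p) //= big1 ?addr0 //.
by move=> q qp; rewrite (coord0 q) ?usG // Ei eq_sym.
Qed.

End GradedBases.

(** * Independence of families indexed by a sequence *)

Section Independence.
Variables (V : vectType 'F_2) (I : eqType) (G : I -> {vspace V}).

Lemma directv_seqP (r : seq I) : uniq r ->
  reflect (forall us, (forall q, q \in r -> us q \in G q) ->
             \sum_(q <- r) us q = 0 -> forall q, q \in r -> us q = 0)
          (directv (\sum_(q <- r) G q)).
Proof.
case: r => [|x0 r'] Ur.
  rewrite directvE /= !big_nil dimv0; apply: ReflectT => us _ _ q; by rewrite in_nil.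
set r := x0 :: r' in Ur *.
have -> : directv (\sum_(q <- r) G q) = directv (\sum_(i < size r) G (nth x0 r i)).
  by rewrite !directvE /= !(big_nth x0) !big_mkord.
apply: (iffP directv_sum_independent) => [H us usG us0 q qr|H us usG us0 i _].
  have iq : (index q r < size r)%N by rewrite index_mem.
  rewrite -(nth_index x0 qr) -[index q r]/(val (Ordinal iq)).
  apply: (H (fun i => us (nth x0 r i))) => // [i _|].
    by apply/usG/mem_nth.
  by rewrite (big_nth x0) big_mkord in us0.
pose vs q := if insub (index q r) is Some i then us i else 0.
have vsE (j : 'I_(size r)) : vs (nth x0 r j) = us j.
  by rewrite /vs index_uniq // valK.
rewrite -vsE; apply: H; last by rewrite mem_nth.
- move=> q qr; have iq : (index q r < size r)%N by rewrite index_mem.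
  rewrite -(nth_index x0 qr) -[index q r]/(val (Ordinal iq)) vsE.
  exact: usG.
- rewrite (big_nth x0) big_mkord -[RHS]us0; apply: eq_bigr => j _.
  by rewrite vsE.
Qed.

End Independence.

(** * Projections onto the degrees *)

Section ZProjections.
Variables (C : chainComplex) (r : seq int).
Hypotheses (r_uniq : uniq r) (r_full : (\sum_(q <- r) Zcomp C q)%VS = fullv).

Definition Zproj q : 'End(C) := sumv_pi (\sum_(q <- r) Zcomp C q)%VS q.

Lemma Zproj_mem q v : Zproj q v \in Zcomp C q.
Proof. exact: memv_sum_pi. Qed.

Lemma Zproj_sum v : \sum_(q <- r) Zproj q v = v.
Proof.
by apply: sumv_pi_uniq_sum; rewrite ?filter_predT // r_full memvf.
Qed.

(** The family [r] already spans and [q :: r] is still independent. Writing [v] through its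
    components in [r] gives a relation whose coefficient at [q] is [v]. *)
Lemma Zcomp_out q v : q \notin r -> v \in Zcomp C q -> v = 0.
Proof.
move=> qr vq; have U : uniq (q :: r) by rewrite /= qr.
have [/(_ _ U)/(directv_seqP _ U) H _] := Zcomp_gradation C.
have /= := H (fun p => if p == q then v else - Zproj p v) _ _ q (mem_head _ _).
rewrite eqxx; apply.
  move=> p _; case: eqP => [->//|_]; first by rewrite memvN Zproj_mem.
rewrite big_cons eqxx -[X in X + _](Zproj_sum v) big_seq [X in _ + X]big_seq.
rewrite -big_split big1 //= => p pr; case: (p =P q) => [E|_]; last exact: subrr.
by case/negP: qr; rewrite -E.
Qed.

Lemma Zproj_id q q' v : v \in Zcomp C q -> Zproj q' v = if q' == q then v else 0.
Proof.
move=> vq; have [/(_ _ r_uniq)/(directv_seqP _ r_uniq) H _] := Zcomp_gradation C.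
have [qr|/Zcomp_out/(_ vq)->] := boolP (q \in r); last by rewrite linear0 if_same.
have E p : p \in r -> Zproj p v - (if p == q then v else 0) = 0.
  apply: (H (fun p => Zproj p v - (if p == q then v else 0))).
    by move=> p' _; apply: memvB (Zproj_mem _ _) _; case: eqP => [->|_] //; apply: mem0v.
  rewrite sumrB Zproj_sum -big_mkcond /= -big_filter.
  rewrite (_ : [seq i <- r | i == q] = [:: q]) ?big_seq1 ?subrr //.
  by rewrite (eq_filter (a2 := pred1 q)) // filter_pred1_uniq.
have [qr'|q'r] := boolP (q' \in r).
  by apply/eqP; rewrite -subr_eq0 (E _ qr').
rewrite (Zcomp_out q'r (Zproj_mem _ _)); case: eqP => // Eq.
by rewrite Eq qr in q'r.
Qed.

Lemma eq_on_Zcomp (W : vectType 'F_2) (f g : 'Hom(C, W)) :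
  (forall q, {in Zcomp C q, f =1 g}) -> f = g.
Proof.
move=> E; apply/lfunP => v; rewrite -(Zproj_sum v) !linear_sum.
by apply: eq_bigr => q _; apply: E; apply: Zproj_mem.
Qed.

Lemma bnd_Zcomp q v : v \in Zcomp C q -> bnd C v \in Zcomp C (q - 1).
Proof. by move=> vq; apply: (subvP (bnd_deg C q)); apply: memv_img. Qed.

Lemma bnd_Zproj q : (bnd C \o Zproj q)%VF = (Zproj (q - 1) \o bnd C)%VF.
Proof.
apply: eq_on_Zcomp => q' v vq'; rewrite !lfunE /= (Zproj_id _ vq').
rewrite (Zproj_id _ (bnd_Zcomp vq')) (inj_eq (addIr _)).
by case: eqP; rewrite ?linear0.
Qed.

Lemma Zproj_Zproj q q' : (Zproj q \o Zproj q')%VF = if q == q' then Zproj q else 0.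
Proof.
apply: eq_on_Zcomp => p v vp; rewrite !lfunE /= (Zproj_id q' vp) (fun_if (Zproj q)).
rewrite linear0 (Zproj_id q vp); case: (q =P q') => [->|ne].
  by rewrite (Zproj_id q' vp); case: (q' == p).
by rewrite lfunE /=; case: (q' =P p) => // E; case: (q =P p) => // E'; case: ne; rewrite E'.
Qed.

End ZProjections.

(** * The Conley complex of the returned matrix *)

Section ConnectionMatrix.
Variables (disp : Order.disp_t) (P : finPOrderType disp).
Variables (C : filteredComplex P) (n : nat) (B : n.-tuple C) (nu : 'I_n -> P).
Hypotheses (compat : compatible_gradations C) (adm : admissible B nu).

Let A := bnd_matrix B.
Let B_graded : graded_basis B nu. Proof. by case: adm. Qed.
Let B_basis : basis_of fullv B. Proof. by case: B_graded. Qed.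
Let B_nu i : tnth B i \in Pcomp C (nu i). Proof. by case: B_graded. Qed.

Lemma bnd_matrix_filt : filt nu nu A.
Proof.
apply/(filteredP (Pcomp_gradation C) B_basis B_nu (Pcomp_gradation C) B_basis B_nu).
exact: bnd_filtered.
Qed.

Lemma bnd_matrix_sq : A *m A = 0.
Proof. by rewrite -[A]/(mat B B (bnd C)) -(mat_comp _ _ B_basis) bnd_bnd mat0. Qed.

(** The compatibility of the two gradations enters here: [Pcomp C p] is spanned by vectors
    homogeneous in degree, and the projection either fixes or kills each of them, so it preserves
    [Pcomp C p]. *)
Lemma Zproj_filt r q : uniq r -> (\sum_(q <- r) Zcomp C q)%VS = fullv ->
  filt nu nu (mat B B (Zproj C r q)).
Proof.
move=> r_uniq r_full i j; rewrite mxE => nz.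
suff H : Zproj C r q (tnth B j) \in Pcomp C (nu j).
  by rewrite (coord_graded (Pcomp_gradation C) B_basis B_nu H nz).
have [s Es] := compat (nu j); have := B_nu j; rewrite {1}Es => {Es nz}.
elim: s (tnth B j) => [|q' s IHs] v; rewrite ?big_nil ?big_cons.
  by rewrite memv0 => /eqP->; rewrite linear0 mem0v.
case/memv_addP => u /memv_capP[uP uZ] [w /IHs wP ->]; rewrite linearD /=.
apply: memvD; last exact: wP.
by rewrite (Zproj_id r_uniq r_full _ uZ); case: ifP; rewrite ?mem0v.
Qed.

Lemma retract_connection_matrix m (g : 'I_m -> P) (D : 'M['F_2]_m)
    (phi : 'M_(n, m)) (psi : 'M_(m, n)) (T : 'M_n) r :
  uniq r -> (\sum_(q <- r) Zcomp C q)%VS = fullv ->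
  sfilt g g D -> filt nu g phi -> filt g nu psi -> filt nu nu T ->
  A *m phi = phi *m D -> D *m psi = psi *m A -> psi *m phi = 1%:M ->
  1%:M + phi *m psi = A *m T + T *m A ->
  (forall q, T *m mat B B (Zproj C r q) = mat B B (Zproj C r (q + 1)) *m T) ->
  (forall q, phi *m psi *m mat B B (Zproj C r q) =
             mat B B (Zproj C r q) *m (phi *m psi)) ->
  connection_matrix C g D.
Proof.
move=> r_uniq r_full sD fphi fpsi fT Aphi Dpsi psiphi htpy TZ pZ.
pose E := [tuple (delta_mx 0 i : 'rV['F_2]_m) | i < m].
have E_basis : basis_of fullv E.
  rewrite basisEfree subvf size_tuple dimvf [dim _]mul1n leqnn !andbT.
  have Ei (i : 'I_m) : E`_i = delta_mx 0 i by rewrite -tnth_nth tnth_mktuple.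
  apply/freeP => k k0 i; move: k0; under eq_bigr => j _ do rewrite Ei.
  move/rowP/(_ i); rewrite summxE (bigD1 i) //= big1 => [|j ji]; rewrite !mxE eqxx.
    by rewrite eqxx mulr1 addr0.
  by rewrite eq_sym (negbTE ji) mulr0.
pose dL := homof E E D; pose phiL := homof E B phi; pose psiL := homof B E psi.
pose TL := homof B B T.
have phiK : mat E B phiL = phi by apply: homofK.
have psiK : mat B E psiL = psi by apply: homofK.
have dK : mat E E dL = D by apply: homofK.
have TK : mat B B TL = T by apply: homofK.
clearbody dL phiL psiL TL.
have H1 : (bnd C \o phiL)%VF = (phiL \o dL)%VF.
  apply: (mat_inj E_basis B_basis).
  by rewrite (mat_comp _ _ B_basis) (mat_comp _ _ E_basis) phiK dK.
have H2 : (dL \o psiL)%VF = (psiL \o bnd C)%VF.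
  apply: (mat_inj B_basis E_basis).
  by rewrite (mat_comp _ _ B_basis) (mat_comp _ _ E_basis) psiK dK.
have H3 : (psiL \o phiL)%VF = \1%VF.
  apply: (mat_inj E_basis E_basis).
  by rewrite (mat_comp _ _ B_basis) phiK psiK (mat1 E_basis).
have H4 q : (phiL \o psiL \o Zproj C r q)%VF = (Zproj C r q \o (phiL \o psiL))%VF.
  apply: (mat_inj B_basis B_basis).
  by rewrite !(mat_comp _ _ B_basis) !(mat_comp _ _ E_basis) phiK psiK.
have H5 q : (TL \o Zproj C r q)%VF = (Zproj C r (q + 1) \o TL)%VF.
  apply: (mat_inj B_basis B_basis).
  by rewrite !(mat_comp _ _ B_basis) TK.
have H6 : \1%VF - (phiL \o psiL)%VF = (bnd C \o TL)%VF + (TL \o bnd C)%VF.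
  apply: (mat_inj B_basis B_basis).
  rewrite !matD matN (mat1 B_basis) !(mat_comp _ _ B_basis) (mat_comp _ _ E_basis).
  by rewrite phiK psiK TK F2mx_oppE.
have psiphiE w : psiL (phiL w) = w.
  by have := congr1 (fun f : 'Hom(_, _) => f w) H3; rewrite !lfunE.
have phiZ q v : v \in Zcomp C q -> phiL (psiL v) \in Zcomp C q.
  move=> vq; have := congr1 (fun f : 'Hom(_, _) => f v) (H4 q).
  rewrite !lfunE /= !lfunE /= (Zproj_id r_uniq r_full _ vq) eqxx => ->.
  exact: Zproj_mem.
(* Since [phi psi] preserves degrees, [phi] maps [Z' q] into [Zcomp C q]. It is injective, so
   independence carries over, and [psi] is onto, so the [Z' q] span. *)
pose Z' q := (psiL @: Zcomp C q)%VS.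
have phiZ' q w : w \in Z' q -> phiL w \in Zcomp C q.
  by case/memv_imgP => v vq ->; apply: phiZ.
have Z'_grad : Zgradation Z'.
  have [dirZ _] := Zcomp_gradation C; split.
    move=> s Us; apply/directv_seqP => // us usZ us0 q qs.
    have /(directv_seqP _ Us)/(_ (phiL \o us)) H := dirZ _ Us.
    rewrite -[us q]psiphiE (_ : phiL (us q) = 0) ?linear0 //.
    apply: H => // [p /usZ/phiZ' //|].
    by rewrite -[LHS](linear_sum phiL) us0 linear0.
  exists r => //; rewrite -limg_sum r_full; apply/vspaceP => w.
  by rewrite memvf -[w]psiphiE memv_img // memvf.
have Z'_deg q : (dL @: Z' q <= Z' (q - 1))%VS.
  apply/subvP => _ /memv_imgP[_ /memv_imgP[v vq ->] ->].
  have := congr1 (fun f : 'Hom(_, _) => f v) H2; rewrite !lfunE /= => ->.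
  by apply/memv_img/bnd_Zcomp.
have dd : (dL \o dL)%VF = 0.
  apply: (mat_inj E_basis E_basis); rewrite (mat_comp _ _ E_basis) mat0 dK.
  by rewrite -[D *m D]mulmx1 -psiphi mulmxA -(mulmxA D) Dpsi mulmxA Dpsi
    -(mulmxA psi) bnd_matrix_sq mulmx0 mul0mx.
pose K := ChainComplex Z'_grad Z'_deg dd.
pose G : P -> {vspace K} := basis_gradation E g.
have G_grad : Pgradation G by apply: basis_gradationP.
have E_g i : tnth E i \in G (g i) by apply: mem_basis_gradation.
have d_filt : filtered G G (bnd K).
  apply/(filteredP G_grad E_basis E_g G_grad E_basis E_g).
  by rewrite [mat _ _ _]dK; apply: sfiltW.
pose Cbar := FilteredComplex G_grad d_filt.
exists Cbar, E; split=> //; split.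
  (* [psi phi] is the identity on the nose, whence the zero homotopy on that side. *)
  exists phiL, psiL, 0, TL; split; split.
  - split=> // q; apply/subvP => _ /memv_imgP[w wq ->].
    exact: phiZ'.
  - apply/(filteredP G_grad E_basis E_g (Pcomp_gradation C) B_basis B_nu).
    by rewrite phiK.
  - by split=> // q.
  - apply/(filteredP (Pcomp_gradation C) B_basis B_nu G_grad E_basis E_g).
    by rewrite psiK.
  - split; first by move=> q; rewrite lim0g sub0v.
    by rewrite H3 subrr comp_lfun0l comp_lfun0r addr0.
  - by apply/(filteredP G_grad E_basis E_g G_grad E_basis E_g); rewrite mat0; apply: filt0.
  - split; last exact: H6.
    move=> q; apply/subvP => _ /memv_imgP[v vq ->].
    have := congr1 (fun f : 'Hom(_, _) => f v) (H5 q); rewrite !lfunE /=.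
    by rewrite (Zproj_id r_uniq r_full _ vq) eqxx => ->; apply: Zproj_mem.
  - apply/(filteredP (Pcomp_gradation C) B_basis B_nu (Pcomp_gradation C) B_basis B_nu).
    by rewrite TK.
move=> p; apply: (hom_entry_eq0 G_grad E_basis E_g G_grad E_basis E_g) => i j Ei Ej.
apply/eqP; apply: contraT; rewrite [mat _ _ _]dK => /sD.
by rewrite Ei Ej ltxx.
Qed.

Lemma ConnectMat_connection_matrix :
  connection_matrix C (kept_grade (nu := nu) (A := A)) (ConnectMat nu A).
Proof.
have [_ [lin lin_ext nu_mono] tri] := adm.
have fA := bnd_matrix_filt; have AA := bnd_matrix_sq.
have [X [Y [S [[fX fY fS] [AX DY YX] XY]]]] :=
  ConnectMat_contraction lin_ext nu_mono fA AA tri.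
have sD := ConnectMat_sfilt lin_ext nu_mono fA AA tri.
have [_ [r r_uniq r_full]] := Zcomp_gradation C.
have fPi q := Zproj_filt (q := q) r_uniq r_full.
have sumPi : \sum_(q <- r) mat B B (Zproj C r q) = 1%:M.
  rewrite -(mat1 B_basis); apply/matrixP => i j; rewrite summxE !mxE lfunE /=.
  rewrite -[in RHS](Zproj_sum r_uniq r_full (tnth B j)) linear_sum.
  by apply: eq_bigr => q _; rewrite mxE.
have PiPi q q' : mat B B (Zproj C r q) *m mat B B (Zproj C r q') =
    if q == q' then mat B B (Zproj C r q) else 0.
  rewrite -(mat_comp _ _ B_basis) (Zproj_Zproj r_uniq r_full).
  by case: eqP; rewrite ?mat0.
have APi q : A *m mat B B (Zproj C r q) = mat B B (Zproj C r (q - 1)) *m A.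
  by rewrite -!(mat_comp _ _ B_basis) (bnd_Zproj r_uniq r_full).
have [phi [psi [T [[f1 f2 f3] [e1 e2 e3] e4 e5 e6]]]] :=
  homogenisation fA fS sD fX fY fPi AA AX DY YX XY r_uniq sumPi PiPi APi.
exact: (retract_connection_matrix r_uniq r_full sD f1 f2 f3 e1 e2 e3 e4 e5 e6).
Qed.

End ConnectionMatrix.

(** * The machine program *)

Local Open Scope nat_scope.

(** Postcondition and time bound in a single judgment; termination is built in because [exec] is a
    function. *)
Definition wp (c : cmd) (Q : memory -> Prop) (T : nat) (m : memory) : Prop :=
  Q (exec c m).1 /\ (exec c m).2 <= T.

Lemma wp_weaken c (Q Q' : memory -> Prop) T T' m :
  wp c Q T m -> (forall m', Q m' -> Q' m') -> T <= T' -> wp c Q' T' m.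
Proof. by move=> [q t] QQ' TT'; split; [apply: QQ'|apply: leq_trans TT']. Qed.

Lemma wp_set x e (Q : memory -> Prop) T m :
  Q (set_reg m x (eval m e)) -> ecost e < T -> wp (SetR x e) Q T m.
Proof. by []. Qed.

Lemma wp_put a e1 e2 e (Q : memory -> Prop) T m :
  Q (set_arr m a (eval m e1) (eval m e2) (eval m e)) ->
  ecost e1 + ecost e2 + ecost e < T -> wp (Put a e1 e2 e) Q T m.
Proof. by []. Qed.

Lemma wp_then c1 c2 (Q : memory -> Prop) T1 T2 m :
  wp c1 (wp c2 Q T2) T1 m -> wp (Then c1 c2) Q (T1 + T2) m.
Proof.
rewrite /wp /=; case: (exec c1 m) => m1 t1 /=; case: (exec c2 m1) => m2 t2 /=.
by move=> [[q l2] l1]; split=> //; apply: leq_add.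
Qed.

Lemma wp_when e c (Q : memory -> Prop) T m :
  (eval m e = 0 -> Q m) -> (eval m e != 0 -> wp c Q T m) ->
  wp (When e c) Q (ecost e + T).+1 m.
Proof.
rewrite /wp /=; case: eqP => /= [E H _|_ _ /(_ isT)].
  by split; [apply: H|rewrite ltnS leq_addr].
by case: (exec c m) => m1 t1 [q l]; split=> //=; rewrite ltnS leq_add2l.
Qed.

Definition run_loop x (body : memory -> memory * nat) (st : memory * nat) k :=
  let: (m', t) := body (set_reg st.1 x k) in (m', (st.2 + t).+1).

Lemma wp_loop_step c x (Inv : nat -> memory -> Prop) T m t k q :
  wp c (Inv q) T (set_reg m x k) ->
  Inv q (run_loop x (exec c) (m, t) k).1 /\
  (run_loop x (exec c) (m, t) k).2 <= t + T.+1.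
Proof.
rewrite /wp /run_loop /=; case: (exec c _) => m' t' /= [q' l].
by split=> //; rewrite addnS ltnS leq_add2l.
Qed.

(** [N] is the actual number of iterations and [b] an a priori bound, so that times depend only on
    [n]. [Inv k] holds after [k] rounds while the register runs from 1, which matches ordinal [k]
    with cell [k.+1]. The term [(ecost e2).+2] pays for the entry and both bounds. *)
Lemma wp_up x e2 c N b (Inv : nat -> memory -> Prop) (Q : memory -> Prop) T m :
  eval m e2 = N -> N <= b -> Inv 0 m -> (forall m', Inv N m' -> Q m') ->
  (forall k m', k < N -> Inv k m' -> wp c (Inv k.+1) T (set_reg m' x k.+1)) ->
  wp (Up x (Cst 1) e2 c) Q (b * T.+1 + (ecost e2).+2) m.
Proof.
move=> EN Nb inv0 post body; rewrite /wp /= EN subn1 /= add1n -/(run_loop x (exec c)).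
suff H q st : q <= N -> Inv (N - q) st.1 ->
    let st' := foldl (run_loop x (exec c)) st (iota (N - q).+1 q) in
    Inv N st'.1 /\ st'.2 <= st.2 + q * T.+1.
  have := H N (m, (ecost e2).+2); rewrite subnn => /(_ (leqnn _) inv0) [i l].
  split; first exact: post.
  apply: (leq_trans l); rewrite addnC leq_add2r.
  by rewrite leq_mul2r Nb orbT.
elim: q st => [|q IHq] [m1 t1] qN inv; first by rewrite subn0 in inv; rewrite /= mul0n addn0.
have kN : N - q.+1 < N by rewrite ltn_subrL (leq_ltn_trans _ qN).
have := wp_loop_step t1 (body _ _ kN inv); rewrite subnSK // => -[i l].
have [i' l'] := IHq (run_loop x (exec c) (m1, t1) (N - q)) (ltnW qN) i.
by split=> //=; apply: (leq_trans l'); rewrite mulSn addnA leq_add2r.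
Qed.

Lemma wp_down x e1 c N b (Inv : nat -> memory -> Prop) (Q : memory -> Prop) T m :
  eval m e1 = N -> N <= b -> Inv N m -> (forall m', Inv 0 m' -> Q m') ->
  (forall k m', k < N -> Inv k.+1 m' -> wp c (Inv k) T (set_reg m' x k.+1)) ->
  wp (Down x e1 (Cst 1) c) Q (b * T.+1 + (ecost e1).+2) m.
Proof.
move=> EN Nb invN post body; rewrite /wp /= EN subn1 /= addn1 -/(run_loop x (exec c)).
suff H q st : q <= N -> Inv q st.1 ->
    let st' := foldl (run_loop x (exec c)) st (rev (iota 1 q)) in
    Inv 0 st'.1 /\ st'.2 <= st.2 + q * T.+1.
  have [i l] := H N (m, (ecost e1).+2) (leqnn _) invN.
  split; first exact: post.
  apply: (leq_trans l); rewrite addnC leq_add2r.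
  by rewrite leq_mul2r Nb orbT.
elim: q st => [|q IHq] [m1 t1] qN inv; first by rewrite /= mul0n addn0.
have -> : iota 1 q.+1 = rcons (iota 1 q) q.+1.
  by rewrite -[in LHS](addn1 q) iotaD cats1 add1n.
have [i l] := wp_loop_step t1 (body _ _ qN inv).
have [i' l'] := IHq (run_loop x (exec c) (m1, t1) q.+1) (ltnW qN) i.
rewrite rev_rcons; split=> //=; apply: (leq_trans l').
by rewrite mulSn addnA leq_add2r.
Qed.

Lemma F2_add_neq0 (x y : 'F_2) : (x + y != 0)%R = ((x != 0%R) != (y != 0%R)).
Proof.
have [->|/F2_neq0->] := eqVneq x 0%R; first by rewrite add0r; case: (y != 0%R).
by have [->|/F2_neq0->] := eqVneq y 0%R; rewrite ?addr0 // F2_addxx eqxx.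
Qed.

Definition find_min_candidate : cmd :=
  Down rS (Reg rN) (Cst 1)
    (When (And (Neq (Reg rS) (Reg rJ))
             (And (Eqn (Low_ (Reg rS)) (Reg rI))
                  (Eqn (Nu_ (Reg rS)) (Nu_ (Reg rI)))))
       (SetR rT (Reg rS))).

Definition add_col_then_row : cmd :=
  Then (Up rK (Cst 1) (Reg rN) (Put aA (Reg rK) (Reg rJ)
          (Neq (A_ (Reg rK) (Reg rJ)) (A_ (Reg rK) (Reg rT)))))
       (Up rK (Cst 1) (Reg rN) (Put aA (Reg rT) (Reg rK)
          (Neq (A_ (Reg rT) (Reg rK)) (A_ (Reg rJ) (Reg rK))))).

Definition inner_body : cmd :=
  When (A_ (Reg rI) (Reg rJ))
    (Then (SetR rT (Cst 0))
       (Then find_min_candidate (When (Neq (Reg rT) (Cst 0)) add_col_then_row))).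

Definition outer_loop : cmd :=
  Up rJ (Cst 1) (Reg rN)
    (Then compute_lows (Down rI (Low_ (Reg rJ)) (Cst 1) inner_body)).

Definition clear_drops : cmd :=
  Up rS (Cst 1) (Reg rN) (Put aDrop (Reg rS) (Cst 0) (Cst 0)).

Definition mark_drops : cmd :=
  Up rS (Cst 1) (Reg rN)
    (When (And (Low_ (Reg rS)) (Eqn (Nu_ (Reg rS)) (Nu_ (Low_ (Reg rS)))))
       (Then (Put aDrop (Reg rS) (Cst 0) (Cst 1))
             (Put aDrop (Low_ (Reg rS)) (Cst 0) (Cst 1)))).

Definition collect_kept : cmd :=
  Up rS (Cst 1) (Reg rN)
    (When (Eqn (Drop_ (Reg rS)) (Cst 0))
       (Then (SetR rM (Add (Reg rM) (Cst 1))) (Put aIdx (Reg rM) (Cst 0) (Reg rS)))).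

Definition copy_out : cmd :=
  Up rI (Cst 1) (Reg rM)
    (Up rJ (Cst 1) (Reg rM)
       (Put aOut (Reg rI) (Reg rJ) (A_ (Idx_ (Reg rI)) (Idx_ (Reg rJ))))).

Lemma ConnectMat_progE : ConnectMat_prog =
  Then outer_loop (Then compute_lows (Then clear_drops (Then mark_drops
    (Then (SetR rM (Cst 0)) (Then collect_kept copy_out))))).
Proof. by []. Qed.

(** * Subroutines of the program *)

Section Commands.
Variables (disp : Order.disp_t) (P : finPOrderType disp).
Variables (n : nat) (nu : 'I_n -> P) (code : 'I_n -> nat).
Hypothesis codeE : forall i j, (code i == code j) = (nu i == nu j).
Implicit Types (A : 'M['F_2]_n) (m : memory) (i j s : 'I_n).

Record holds A m : Prop := Holds {
  holds_n : reg m rN = n;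
  holds_A : forall i j, arr m aA i.+1 j.+1 = (A i j != 0%R);
  holds_nu : forall i, arr m aNu i.+1 0 = code i }.

Definition lows A m := forall s, arr m aLow s.+1 0 = low A s.

Lemma holds_reg A m x v : x != rN -> holds A m -> holds A (set_reg m x v).
Proof. by move=> xN [h1 h2 h3]; split=> //=; rewrite eq_sym (negbTE xN). Qed.

Lemma holds_arr A m a k l v : aA != a -> aNu != a -> holds A m ->
  holds A (set_arr m a k l v).
Proof.
move=> aA' aNu' [h1 h2 h3]; split=> [|i j|i] //=; first by rewrite (negbTE aA') h2.
by rewrite (negbTE aNu') h3.
Qed.

Lemma holds_put A A' m i j : holds A m ->
    (forall k l, A' k l = if (k == i) && (l == j) then A' i j else A k l) ->
  holds A' (set_arr m aA i.+1 j.+1 (A' i j != 0%R)).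
Proof.
move=> [h1 h2 h3] E; split=> [|k l|k] //=.
by rewrite [A' k l]E !eqSS !val_eqE; case: ifP => // _.
Qed.

Lemma wp_compute_lows A m : holds A m ->
  wp compute_lows
    (fun m' => [/\ holds A m', lows A m' & reg m' rJ = reg m rJ])
    (n * (4 + (n * 9 + 3)).+1 + 3) m.
Proof.
move=> hA.
pose Inv k m' := [/\ holds A m', reg m' rJ = reg m rJ
  & forall s, s < k -> arr m' aLow s.+1 0 = low A s].
apply: (wp_up (Inv := Inv) (N := n) (b := n) (T := 4 + (n * 9 + 3))) => //.
- exact: holds_n hA.
- by move=> m' [h1 h2 h3]; split=> // s; apply: h3.
move=> k m1 kn [h1 h2 h3]; pose s := Ordinal kn.
apply/wp_then/wp_put => //=.
(* The stored value is pinned by two inequalities, above every nonzero row scanned so far and at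
   most the true low; they meet when [q = n]. *)
pose InvK q m' := [/\ holds A m', reg m' rJ = reg m rJ, reg m' rS = k.+1,
  forall s, s < k -> arr m' aLow s.+1 0 = low A s
  & (forall i, i < q -> A i s != 0%R -> i < arr m' aLow k.+1 0) /\
    arr m' aLow k.+1 0 <= low A s].
apply: (wp_up (Inv := InvK) (N := n) (b := n) (T := 8)) => //.
- exact: holds_n h1.
- split=> //=.
  + by apply: holds_arr => //; apply: holds_reg.
  + by move=> s' ls; rewrite /= eqSS (ltn_eqF ls) h3.
  + by rewrite !eqxx.
- move=> m' [g1 g2 g3 g4 [g5 g6]]; split=> // s'; rewrite ltnS leq_eqVlt.
  case/orP=> [/eqP E|]; last exact: g4.
  have -> : s' = s by apply: val_inj.
  apply/eqP; rewrite eqn_leq g6 /=; apply: low_le => i; exact: g5.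
move=> q m2 qn [g1 g2 g3 g4 [g5 g6]]; pose i := Ordinal qn.
apply: wp_when => /=; rewrite g3 (holds_A g1 i s) => Ais.
  split=> //; first exact: holds_reg.
  split=> // i'; rewrite ltnS leq_eqVlt => /orP[/eqP E|]; last exact: g5.
  by rewrite (_ : i' = i) in Ais *; [move: Ais; case: (A i s != 0%R)|apply: val_inj].
apply: wp_put => //=; rewrite g3; split=> //=.
- by apply: holds_arr => //; apply: holds_reg.
- by move=> s' ls; rewrite eqSS (ltn_eqF ls) g4.
- rewrite !eqxx /=; split=> //; apply: (low_gt (k := i)).
  by move: Ais; case: (A i s != 0%R).
Qed.

(** The scan descends and overwrites, so the register ends with the least candidate. The stored lows
    are those of [A1], and [stable] transfers the test to [A]; once the low is row [i], comparing
    grades with [i] decides homogeneity. *)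
Lemma wp_find_min_candidate A A1 j i m :
    holds A m -> lows A1 m -> reg m rJ = j.+1 -> reg m rI = i.+1 -> reg m rT = 0 ->
    (forall t : 'I_n, t != j -> (low A t == i.+1) = (low A1 t == i.+1)) ->
  wp find_min_candidate (fun m' =>
    [/\ holds A m', lows A1 m', reg m' rJ = j.+1
      & (reg m' rT = 0 /\ candidates nu A i j = set0) \/
        exists s : 'I_n, [/\ reg m' rT = s.+1, s \in candidates nu A i j
          & forall t : 'I_n, t \in candidates nu A i j -> s <= t]])
    (n * 21 + 3) m.
Proof.
move=> h1 h2 h3 h4 h5 stable.
pose Inv q m' := [/\ holds A m', lows A1 m', reg m' rJ = j.+1, reg m' rI = i.+1
  & (reg m' rT = 0 /\ forall t : 'I_n, q <= t -> t \notin candidates nu A i j) \/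
    exists s : 'I_n, [/\ reg m' rT = s.+1, s \in candidates nu A i j
      & forall t : 'I_n, q <= t -> t \in candidates nu A i j -> s <= t]].
apply: (wp_down (Inv := Inv) (N := n) (b := n) (T := 20)) => //.
- exact: holds_n h1.
- by split=> //; left; split=> // t; rewrite leqNgt ltn_ord.
- move=> m' [g1 g2 g3 g4 g5]; split=> //.
  case: g5 => [[rT0 H]|[s [rTs sS H]]]; [left|right].
    by split=> //; apply/setP => t; rewrite in_set0; apply/negbTE/H.
  by exists s; split=> // t; apply: H.
move=> q m1 qn [g1 g2 g3 g4 g5]; pose s := Ordinal qn.
apply: wp_when => /=;
  rewrite g3 g4 (g2 s) (holds_nu g1 s) (holds_nu g1 i) !eqb0 !negbK codeE eqSS.
all: have -> : [&& q != j, low A1 s == i.+1 & nu s == nu i] = (s \in candidates nu A i j).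
- by rewrite inE -val_eqE /=; case: eqP => //= /eqP sj; rewrite -stable //;
     case: eqP => //= /homE->.
2: by rewrite inE -val_eqE /=; case: eqP => //= /eqP sj; rewrite -stable //;
     case: eqP => //= /homE->.
- move/eqP; rewrite eqb0 => nS; split=> //; first exact: holds_reg.
  case: g5 => [[rT0 H]|[s' [rTs sS H]]]; [left|right].
    split=> // t; rewrite leq_eqVlt => /orP[/eqP E|]; last exact: H.
    by rewrite (_ : t = s) //; apply: val_inj.
  exists s'; split=> // t; rewrite leq_eqVlt => /orP[/eqP E|]; last exact: H.
  by rewrite (_ : t = s) ?(negbTE nS) //; apply: val_inj.
- move=> sS; apply: wp_set => //=; split=> //=; first by do 2! apply: holds_reg => //.
  right; exists s; split=> //.
Qed.

Lemma wp_add_col_then_row A j s m :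
    holds A m -> reg m rJ = j.+1 -> reg m rT = s.+1 -> s != j ->
  wp add_col_then_row (fun m' =>
    [/\ holds (addrow j s (addcol s j A)) m', reg m' rJ = j.+1
      & forall k, arr m' aLow k 0 = arr m aLow k 0])
    (n * 11 + 3 + (n * 11 + 3)) m.
Proof.
move=> h1 h2 h3 sj.
(* The matrix after [q] in-place updates. As [s != j], the column [s] being read is not overwritten,
   and likewise row [j] in the second loop. *)
pose Ac (q : nat) : 'M['F_2]_n :=
  (\matrix_(x, y) if (y == j) && (x < q)%N then A x y + A x s else A x y)%R.
pose InvC q m' := [/\ holds (Ac q) m', reg m' rJ = j.+1, reg m' rT = s.+1
  & forall k, arr m' aLow k 0 = arr m aLow k 0].
apply: wp_then.
apply: (wp_up (Inv := InvC) (N := n) (b := n) (T := 10)) => //.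
- exact: holds_n h1.
- split=> //; rewrite (_ : Ac 0 = A) //; apply/matrixP => x y; rewrite mxE.
  by rewrite ltn0 andbF.
- move=> m1 [g1 g2 g3 g4].
  have Acn : Ac n = addcol s j A.
    by apply/matrixP => x y; rewrite !mxE ltn_ord andbT; case: eqP => // ->.
  rewrite {}Acn in g1; set A' := addcol s j A in g1 *.
  pose Ar (q : nat) : 'M['F_2]_n :=
    (\matrix_(x, y) if (x == s) && (y < q)%N then A' x y + A' j y else A' x y)%R.
  pose InvR q m' := [/\ holds (Ar q) m', reg m' rJ = j.+1, reg m' rT = s.+1
    & forall k, arr m' aLow k 0 = arr m aLow k 0].
  apply: (wp_up (Inv := InvR) (N := n) (b := n) (T := 10)) => //.
  + exact: holds_n g1.
  + split=> //; rewrite (_ : Ar 0 = A') //; apply/matrixP => x y; rewrite mxE.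
    by rewrite ltn0 andbF.
  + move=> m2 [f1 f2 f3 f4]; split=> //.
    rewrite (_ : addrow _ _ _ = Ar n) //; apply/matrixP => x y.
    by rewrite [LHS]mxE [RHS]mxE ltn_ord andbT; case: eqP => // ->.
  + move=> q m2 qn [f1 f2 f3 f4]; pose y := Ordinal qn.
    apply: wp_put => //=; rewrite f2 f3; split=> //=.
    have -> : (arr m2 aA s.+1 q.+1 != arr m2 aA j.+1 q.+1) = (Ar q.+1 s y != 0%R).
      rewrite (holds_A f1 s y) (holds_A f1 j y) [Ar q s y]mxE [Ar q j y]mxE.
      rewrite [Ar q.+1 s y]mxE /= ltnn !andbF eqxx ltnSn /= F2_add_neq0.
      by do 2 case: (_ != 0%R).
    rewrite -[q]/(val y); apply: (holds_put (A := Ar y)) => [|k l].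
      by apply: holds_reg.
    rewrite ![Ar _ _ _]mxE !eqxx ltnS leq_eqVlt /= ltnSn; case: (k =P s) => [->|] //=.
    by rewrite -val_eqE /=; case: eqP => // E; rewrite (_ : l = y) //; apply: val_inj.
- move=> q m1 qn [g1 g2 g3 g4]; pose x := Ordinal qn.
  apply: wp_put => //=; rewrite g2 g3; split=> //=.
  have -> : (arr m1 aA q.+1 j.+1 != arr m1 aA q.+1 s.+1) = (Ac q.+1 x j != 0%R).
    rewrite (holds_A g1 x j) (holds_A g1 x s) [Ac q x j]mxE [Ac q x s]mxE.
    rewrite [Ac q.+1 x j]mxE (negbTE sj) /= ltnn !andbF eqxx ltnSn /= F2_add_neq0.
    by do 2 case: (_ != 0%R).
  rewrite -[q]/(val x); apply: (holds_put (A := Ac x)) => [|k l].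
    by apply: holds_reg.
  rewrite ![Ac _ _ _]mxE !eqxx ltnS leq_eqVlt /= ltnSn andbC.
  case: (l =P j) => [->|_] /=; last by rewrite !andbF.
  by rewrite -val_eqE /= !andbT; case: eqP => // E; rewrite (_ : k = x) //; apply: val_inj.
Qed.

End Commands.

(** * The whole run and its cost *)

Section Execution.
Variables (disp : Order.disp_t) (P : finPOrderType disp).
Variables (n : nat) (nu : 'I_n -> P) (code : 'I_n -> nat) (lin : rel P).
Variable A0 : 'M['F_2]_n.
Hypothesis codeE : forall i j, (code i == code j) = (nu i == nu j).
Hypotheses (lin_ext : linear_extension lin)
  (nu_mono : forall i j : 'I_n, (i <= j)%N -> lin (nu i) (nu j))
  (A0_filt : filt nu nu A0) (A0_sq : (A0 *m A0 = 0)%R)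
  (A0_tri : forall i j, A0 i j != 0%R -> (i < j)%N).
Implicit Types (A : 'M['F_2]_n) (m : memory) (i j s : 'I_n).

Local Notation holds := (holds code).

(** Cost of the test, the reset, the search, the second test and the two additions. It is linear in
    [n], and there are at most [n^2] inner steps. *)
Definition inner_time := (3 + (2 + (n * 21 + 3 + (3 + (n * 11 + 3 + (n * 11 + 3))).+1))).+1.

Lemma wp_inner_body A A1 j i m : inner_inv nu A0 A1 j i.+1 A ->
    holds A m -> lows A1 m -> reg m rJ = j.+1 -> reg m rI = i.+1 ->
  wp inner_body (fun m' =>
    [/\ holds (inner_step nu j A i) m', lows A1 m' & reg m' rJ = j.+1]) inner_time m.
Proof.
move=> inv h1 h2 h3 h4.
apply: wp_when => /=; rewrite h3 h4 (holds_A h1 i j).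
  move/eqP; rewrite eqb0 negbK => /eqP Aij.
  by case: innerP => [_|s Aij1]; [split|rewrite Aij1 in Aij].
rewrite eqb0 negbK => Aij.
have ij := inner_tri inv (leqnn j) Aij.
apply/wp_then/wp_set => //; apply: wp_then.
apply: (wp_weaken (wp_find_min_candidate codeE (A := A) (A1 := A1) (i := i) (j := j)
  _ _ _ _ _ _)) => //=.
- exact: holds_reg.
- by move=> t tj; apply: (inner_stable inv).
move=> m' [g1 g2 g3 g4]; apply: wp_when => /=.
  move/eqP; rewrite eqb0 negbK => /eqP rT0.
  case: g4 => [[_ S0]|[s [rTs]]]; last by rewrite rT0 in rTs.
  by case: innerP => [_|s _]; [split|rewrite S0 in_set0].
rewrite eqb0 negbK => rT0; case: g4 => [[rTs]|[s [rTs sS smin]]].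
  by rewrite rTs in rT0.
have [sj _ _] := candidatesP _ _ _ _ _ sS.
apply: (wp_weaken (wp_add_col_then_row g1 g3 rTs sj)) => // m2 [f1 f2 f3].
split=> //; last by move=> t; rewrite f3.
case: innerP => [[E|E]|s' _ s'S s'min].
- by rewrite E eqxx in Aij.
- by rewrite E in_set0 in sS.
- suff -> : s' = s by [].
  by apply: val_inj; apply/eqP; rewrite eqn_leq smin // s'min.
Qed.

Definition outer_time :=
  n * (n * (4 + (n * 9 + 3)).+1 + 3 + (n * inner_time.+1 + 5)).+1 + 3.

Lemma wp_outer_loop m : holds A0 m ->
  wp outer_loop (holds (reduce nu A0)) outer_time m.
Proof.
move=> h0.
apply: (wp_up (Inv := fun k => holds (reduce_upto nu A0 k)) (N := n) (b := n)) => //.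
- exact: holds_n h0.
- by rewrite reduce_upto0.
- by rewrite reduce_upton.
move=> k m1 kn h1; pose j := Ordinal kn; pose A1 := reduce_upto nu A0 j.
have oinv : outer_inv nu A0 j A1.
  by apply: (reduce_upto_inv lin_ext nu_mono) => //; apply: ltnW.
apply: wp_then.
have h1' : holds A1 (set_reg m1 rJ k.+1) by apply: holds_reg.
apply: (wp_weaken (wp_compute_lows h1')) => // m2 [g1 g2 g3].
(* The intermediate matrix is described by its future: scanning the remaining [q] rows from it must
   give [outer_step]. *)
pose Inv q m' := exists A, [/\ holds A m', lows A1 m', reg m' rJ = j.+1,
  inner_inv nu A0 A1 j q A & scan nu j A q = outer_step nu A1 j].
apply: (wp_down (Inv := Inv) (N := low A1 j) (b := n)) => //=.
- by rewrite g3 /= (g2 j).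
- exact: low_ltn.
- exists A1; split=> //; exact: (inner_start A0_sq).
- move=> m' [A [f1 _ _ _]]; rewrite scan0 => E.
  by rewrite (reduce_uptoS nu A0 j) -/A1 -E.
move=> q m3 qn [A [f1 f2 f3 f4 f5]].
have qn' : q < n by apply: leq_trans qn (low_ltn _ _).
pose i := Ordinal qn'.
apply: (wp_weaken (wp_inner_body (A := A) (A1 := A1) (j := j) (i := i) f4 _ _ _ _)) => //.
- exact: holds_reg.
move=> m4 [e1 e2 e3]; exists (inner_step nu j A i); split=> //.
  exact: (inner_next (i := i) A0_filt f4).
by rewrite -f5 (scanS _ _ _ (i := i)).
Qed.

Let R := reduce nu A0.

Lemma wp_clear_drops m : holds R m -> lows R m ->
  wp clear_drops (fun m' => [/\ holds R m', lows R m'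
    & forall i, arr m' aDrop i.+1 0 = 0]) (n * 5 + 3) m.
Proof.
move=> h1 h2.
pose Inv k m' := [/\ holds R m', lows R m' & forall i, i < k -> arr m' aDrop i.+1 0 = 0].
apply: (wp_up (Inv := Inv) (N := n) (b := n) (T := 4)) => //.
- exact: holds_n h1.
- by move=> m' [g1 g2 g3]; split=> // i; apply: g3.
move=> k m' kn [g1 g2 g3]; apply: wp_put => //=; split=> //=.
  by apply: holds_arr => //; apply: holds_reg.
move=> i; rewrite ltnS eqSS leq_eqVlt andbT.
by case: eqP => //= _; apply: g3.
Qed.

Lemma wp_mark_drops m : holds R m -> lows R m ->
    (forall i, arr m aDrop i.+1 0 = 0) ->
  wp mark_drops (fun m' => holds R m' /\
    forall i, arr m' aDrop i.+1 0 = (i \notin kept nu A0)) (n * 25 + 3) m.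
Proof.
move=> h1 h2 h3.
pose f i s := homogeneous nu R s && ((i == s) || (low R s == i.+1)).
pose Inv k m' := [/\ holds R m', lows R m'
  & forall i, arr m' aDrop i.+1 0 = [exists s : 'I_n, (s < k) && f i s]].
apply: (wp_up (Inv := Inv) (N := n) (b := n) (T := (13 + (4 + 6)).+1)) => //.
- exact: holds_n h1.
- split=> // i; rewrite h3; symmetry; apply/eqP; rewrite eqb0; apply/existsP.
  by case=> s; rewrite ltn0.
- move=> m' [g1 g2 g3]; split=> // i; rewrite g3; congr nat_of_bool.
  rewrite !inE negbK -/R; apply/existsP/orP => [[s /and3P[_ hs /orP[/eqP->|El]]]|].
  + by left.
  + by right; apply/existsP; exists s; rewrite hs.
  + case=> [hi|/existsP[s /andP[hs El]]].
      by exists i; rewrite ltn_ord /f hi eqxx.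
    by exists s; rewrite ltn_ord /f hs El orbT.
move=> k m1 kn [g1 g2 g3]; pose s := Ordinal kn.
(* For a zero column the program reads grade cell 0, whose content is arbitrary; the conjunct
   [low R s != 0] masks it. *)
have condE : (low R s != 0) && ((arr m1 aNu s.+1 0 == arr m1 aNu (low R s) 0 : nat) != 0)
    = homogeneous nu R s.
  rewrite eqb0 negbK (holds_nu g1 s).
  have [E0|] := posnP (low R s).
    by rewrite E0 /=; apply/esym/negbTE/negP => /homP[i]; rewrite E0.
  by move/lowS=> [i Ei _]; rewrite (homE nu Ei) Ei (holds_nu g1 i) codeE.
have exS i : [exists t : 'I_n, (t < k.+1) && f i t] =
    [exists t : 'I_n, (t < k) && f i t] || f i s.
  apply/existsP/orP => [[t /andP[]]|[/existsP[t /andP[tk ft]]|fs]].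
  - rewrite ltnS leq_eqVlt => /orP[/eqP E|tk] ft; last first.
      by left; apply/existsP; exists t; rewrite tk.
    by right; rewrite (_ : s = t) //; apply: val_inj.
  - by exists t; rewrite ft ltnS ltnW.
  - by exists s; rewrite ltnSn fs.
apply: wp_when => /=; rewrite (g2 s) condE.
  move/eqP; rewrite eqb0 => /negbTE nh; split=> //; first exact: holds_reg.
  by move=> i; rewrite /= g3 exS /f nh orbF.
rewrite eqb0 negbK => hs.
apply/wp_then/wp_put => //=; apply: wp_put => //=.
rewrite (g2 s); split=> //=.
  by do 2! (apply: holds_arr => //); apply: holds_reg.
move=> i; rewrite exS g3 /f hs /= andbT eqSS -(eq_sym i.+1) andbT.
rewrite -[i == s]val_eqE /=.
by case: (i.+1 == low R s); case: (val i == k); rewrite ?orbT ?orbF.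
Qed.

Lemma wp_collect_kept m : holds R m ->
    (forall i, arr m aDrop i.+1 0 = (i \notin kept nu A0)) -> reg m rM = 0 ->
  wp collect_kept (fun m' => [/\ holds R m', reg m' rM = #|kept nu A0|
    & forall k : 'I_#|kept nu A0|, arr m' aIdx k.+1 0 = (enum_val k).+1])
    (n * 15 + 3) m.
Proof.
move=> h1 h2 h3.
pose L (k : nat) := [seq i <- [seq i : 'I_n <- enum 'I_n | i < k] | i \in kept nu A0].
pose Inv k m' := [/\ holds R m', forall i, arr m' aDrop i.+1 0 = (i \notin kept nu A0),
  reg m' rM = size (L k)
  & forall q, q < size (L k) -> arr m' aIdx q.+1 0 = (nth 0 (map val (L k)) q).+1].
apply: (wp_up (Inv := Inv) (N := n) (b := n) (T := (5 + (4 + 4)).+1)) => //.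
- exact: holds_n h1.
- have L0 : L 0 = [::].
    by rewrite /L (eq_filter (a1 := fun i : 'I_n => i < 0) (a2 := pred0)) ?filter_pred0.
  by split; rewrite // L0.
- move=> m' [g1 g2 g3 g4].
  have Ln : L n = enum (kept nu A0).
    rewrite /L (_ : [seq i : 'I_n <- _ | i < n] = enum 'I_n); last first.
      by apply/all_filterP/allP => i _ /=.
    by rewrite enumT.
  rewrite Ln -cardE in g3 g4; split=> // k; rewrite g4 //.
  congr _.+1; rewrite (nth_map (enum_val k)) -?cardE //.
  by rewrite -enum_val_nth.
move=> k m1 kn [g1 g2 g3 g4]; pose s := Ordinal kn.
have LS : L k.+1 = if s \in kept nu A0 then rcons (L k) s else L k.
  by rewrite /L (filter_lt_enumS (i := s)) // filter_rcons.
apply: wp_when => /=; rewrite (g2 s).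
  move/eqP; rewrite eqb0 eqb0 negbK => ns; split=> //; first exact: holds_reg.
  - by rewrite LS (negbTE ns).
  - by rewrite LS (negbTE ns).
rewrite !eqb0 !negbK => sK.
apply/wp_then/wp_set => //=; apply: wp_put => //=; split=> //=.
- by apply: holds_arr => //; do 2! (apply: holds_reg => //).
- by rewrite LS sK size_rcons g3 addn1.
- move=> q; rewrite LS sK size_rcons map_rcons ltnS leq_eqVlt addn1 g3 eqSS andbT.
  rewrite nth_rcons size_map; case: eqP => [->|_] /=; first by rewrite ltnn.
  by move=> lq; rewrite lq g4.
Qed.

Lemma wp_copy_out m : holds R m -> reg m rM = #|kept nu A0| ->
    (forall k : 'I_#|kept nu A0|, arr m aIdx k.+1 0 = (enum_val k).+1) ->
  wp copy_out (fun m' => holds_output nu A0 m') (n * (n * 11 + 3).+1 + 3) m.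
Proof.
move=> h1 h2 h3; set K := #|kept nu A0| in h2 h3 *.
have Kn : K <= n by rewrite -[leqRHS]card_ord max_card.
pose Good m' := [/\ holds R m', reg m' rM = K
  & forall k : 'I_K, arr m' aIdx k.+1 0 = (enum_val k).+1].
pose Inv q m' := Good m' /\ forall k l : 'I_K, k < q ->
  arr m' aOut k.+1 l.+1 = (ConnectMat nu A0 k l != 0%R).
apply: (wp_up (Inv := Inv) (N := K) (b := n) (T := n * 11 + 3)) => //.
- by move=> m' [[g1 g2 g3] g4]; split=> // k l; apply: g4.
move=> q m1 qK [[g1 g2 g3] g4]; pose k := Ordinal qK.
pose InvR p m' := [/\ Good m', reg m' rI = q.+1
  & forall k' l : 'I_K, (k' < q) || (k' == k) && (l < p) ->
    arr m' aOut k'.+1 l.+1 = (ConnectMat nu A0 k' l != 0%R)].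
apply: (wp_up (Inv := InvR) (N := K) (b := n) (T := 10)) => //.
- split=> //; first by split=> //; apply: holds_reg.
  by move=> k' l; rewrite ltn0 andbF orbF; apply: g4.
- move=> m' [f1 f2 f3]; split=> // k' l; rewrite ltnS leq_eqVlt => /orP[/eqP E|lt].
    by apply: f3; rewrite (_ : k' = k) ?eqxx ?ltn_ord ?orbT //; apply: val_inj.
  by apply: f3; rewrite lt.
move=> p m2 pK [[f1 f2 f3] f4 f5]; pose l := Ordinal pK.
apply: wp_put => //=; rewrite f4; split=> //=.
  by split=> //=; apply: holds_arr => //; apply: holds_reg.
move=> k' l'; rewrite (f3 k) (f3 l) (holds_A f1) !eqSS ltnS => H.
have [/andP[/eqP Ek /eqP El]|nkl] := ifP.
  by rewrite (_ : k' = k) 1?(_ : l' = l) ?mxE //; apply: val_inj.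
apply: f5; case/orP: H => [-> //|/andP[/eqP Ek]]; rewrite leq_eqVlt => /orP[El|->].
  by rewrite Ek El eqxx in nkl.
by rewrite Ek eqxx orbT.
Qed.

Lemma exec_ConnectMat_prog m :
    holds_input nu A0 m -> code =1 (fun i => arr m aNu i.+1 0) ->
  wp ConnectMat_prog (holds_output nu A0)
    (outer_time + (n * (4 + (n * 9 + 3)).+1 + 3 + (n * 5 + 3 + (n * 25 + 3 +
      (2 + (n * 15 + 3 + (n * (n * 11 + 3).+1 + 3))))))) m.
Proof.
move=> [i1 i2 i3] codeE'; rewrite ConnectMat_progE.
have h0 : holds A0 m by split.
apply: wp_then; apply: (wp_weaken (wp_outer_loop h0)) => // m1 h1.
apply: wp_then; apply: (wp_weaken (wp_compute_lows h1)) => // m2 [h2 l2 _].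
apply: wp_then; apply: (wp_weaken (wp_clear_drops h2 l2)) => // m3 [h3 l3 d3].
apply: wp_then; apply: (wp_weaken (wp_mark_drops h3 l3 d3)) => // m4 [h4 d4].
apply/wp_then/wp_set => //=.
have h5 : holds R (set_reg m4 rM 0) by apply: holds_reg.
apply: wp_then; apply: (wp_weaken (wp_collect_kept h5 d4 _)) => // m6 [h6 c6 x6].
exact: wp_copy_out.
Qed.

End Execution.

Theorem theorem4p2 :
  exists K : nat,
  forall (disp : Order.disp_t) (P : finPOrderType disp)
         (C : filteredComplex P) (n : nat) (B : n.-tuple C) (nu : 'I_n -> P),
    compatible_gradations C -> admissible B nu ->
    let A := bnd_matrix B in
    connection_matrix C (kept_grade (nu := nu) (A := A)) (ConnectMat nu A) /\
    forall m : memory, holds_input nu A m ->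
      let: (m', t) := exec ConnectMat_prog m in
      holds_output nu A m' /\ ((0 < n)%N -> (t <= K * n ^ 3)%N).
Proof.
(* The bound obtained is [52 n^3 + 48 n^2 + 66 n + 20], at most [186 n^3] for positive [n]; 500 is a
   generous round value. *)
exists 500 => disp P C n B nu compat adm A; split.
  exact: ConnectMat_connection_matrix.
move=> m inp; have [_ [lin lin_ext nu_mono] tri] := adm.
have fA := bnd_matrix_filt adm; have AA := bnd_matrix_sq adm.
have [_ _ codeE] := inp.
have := exec_ConnectMat_prog codeE lin_ext nu_mono fA AA tri inp (frefl _).
rewrite /wp; case: (exec _ _) => m' t /= [out le]; split=> // n0.
apply: (leq_trans le); rewrite /outer_time /inner_time.
have : n <= n * n by rewrite leq_pmull.
have : n * n <= n * n * n by rewrite leq_pmulr.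
rewrite (_ : n ^ 3 = n * n * n); last by rewrite !expnS expn0; lia.
nia.
Qed.
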